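(* Let $(M^{4n},Q,\omega)$, $n>1$, be a quaternionic skew-Hermitian manifold, $\hat\pi:\hat M\to M$ its Swann bundle with the almost hypercomplex structure $\hat H=(\hat I_1,\hat I_2,\hat I_3)$, and set $G:=\mathbb{R}_+\times\mathrm{SO}(3)$ (its structure group). (1) The pullback $\hat\omega:=\hat\pi^*(\omega)\in\Omega^2(\hat M)$ is a horizontal, $G$-invariant, closed 2-form on $\hat M$, satisfying $\mathcal{L}_Z\hat\omega=0$ for any vertical vector field $Z\in\hat{\mathcal V}$. (2) The restriction $\hat\omega_{\hat{\mathcal H}}:=\hat\omega|_{\hat{\mathcal H}\times\hat{\mathcal H}}$ of $\hat\omega$ to the horizontal distribution $\hat{\mathcal H}=\ker\hat\theta\subset T\hat M$ is non-degenerate, closed and $\hat H$-Hermitian. Here, since $\hat\omega$ is horizontal, the differential of $\hat\omega_{\hat{\mathcal H}}$ is defined as a section of $\wedge^3\hat{\mathcal H}^*$ and coincides with the restriction of the differential of $\hat\omega$.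
   Context: All manifolds are smooth and connected. An almost quaternionic structure on $M^{4n}$ is a rank-3 subbundle $Q\subset\mathrm{End}(TM)$ locally spanned by an admissible frame $I_1,I_2,I_3$ with $I_1^2=I_2^2=I_3^2=-\mathrm{Id}=I_1I_2I_3$. A scalar 2-form with respect to $Q$ is a non-degenerate 2-form $\omega$ with $\omega(I_aX,I_aY)=\omega(X,Y)$. $(M,Q,\omega)$ is a quaternionic skew-Hermitian manifold if there is a (necessarily unique) torsion-free connection $\nabla=\nabla^{Q,\omega}$ preserving $Q$ with $\nabla\omega=0$ (so $\omega$ is closed). Swann bundle. Let $\pi_S:S\to M$ be the principal $\mathrm{SO}(3)$-bundle (right action) of admissible frames $s=(I_1,I_2,I_3)$ of $Q$, $I_1I_2=I_3$, and $S_0=(\wedge^{4n}T^*M\setminus\{0\})/\mathbb{Z}_2$ the principal $\mathbb{R}_+$-bundle of volume forms up to sign, trivialized as $S_0=M\times\mathbb{R}_+$ by the $\nabla$-parallel section $\omega^{2n}$, with fibre coordinate $t$. The Swann bundle is $\hat M=S_0\times_MS\cong\mathbb{R}_+\times S$, a principal bundle over $M$ with group $\mathbb{R}_+\times\mathrm{SO}(3)\cong\mathbb{H}^\times/\mathbb{Z}_2$ and projection $\hat\pi$. The Lie algebra $\mathbb{H}=\mathbb{R}\oplus\mathfrak{sp}(1)$ has basis $e_0=1$, $(e_1,e_2,e_3)=(i,j,k)$, with $[e_a,e_b]=2e_c$ for cyclic $(a,b,c)$. Let $\theta=\sum_a\theta_ae_a:TS\to\mathfrak{sp}(1)\cong\mathfrak{so}(3)$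 be the connection form on $S$ induced by $\nabla$; on $\hat M$ we have the connection form $\hat\theta=t^{-1}dt+\theta$. Put $\hat{\mathcal V}=\ker d\hat\pi$, $\hat{\mathcal H}=\ker\hat\theta$, and let $Z_0,\dots,Z_3$ be the fundamental vector fields of $e_0,\dots,e_3$. Define $\hat I_a$, for $(a,b,c)$ a cyclic permutation of $(1,2,3)$, by $\hat I_aZ_0=-Z_a$, $\hat I_aZ_a=Z_0$, $\hat I_aZ_b=Z_c$, $\hat I_aZ_c=-Z_b$, and, at a point $u$ with $S$-component $s=(I_1,I_2,I_3)$, $(\hat I_a)_u(Y)=$ the horizontal lift to $\hat{\mathcal H}_u$ of $I_a(\hat\pi_*Y)$ for $Y\in\hat{\mathcal H}_u$. A form is horizontal if it is annihilated by contraction with vertical vectors; a 2-form $\beta$ is $\hat H$-Hermitian if $\beta(\hat I_aX,\hat I_aY)=\beta(X,Y)$ for $a=1,2,3$. *)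

(* Defs.v *)
From HB Require Import structures.
From mathcomp Require Import all_boot all_order all_algebra.
From mathcomp Require Import all_classical all_reals all_analysis.
From mathcomp Require Import ring.

Set Implicit Arguments.
Unset Strict Implicit.
Unset Printing Implicit Defensive.

Import Order.TTheory GRing.Theory Num.Theory.
Import numFieldNormedType.Exports.

Local Open Scope classical_set_scope.
Local Open Scope ring_scope.

(** * Smooth functions on R^N *)

Section SmoothFunctions.
Context {R : realType} {N : nat}.
Implicit Types (F : 'rV[R]_N -> R) (x : 'rV[R]_N).

Definition partial (i : 'I_N) F : 'rV[R]_N -> R :=
  fun x => 'D_(delta_mx 0 i) F x.

(* C^oo on a neighbourhood of x: there, all iterated partial derivatives exist
   and are differentiable. *)
Definition smooth_near x F : Prop :=
  \forall y \near x, forall l : seq 'I_N, differentiable (foldr partial F l) y.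

End SmoothFunctions.

(** * Spaces with germs of smooth functions

    [nbh p] is the neighbourhood filter of [p] and [smooth p f] says that [f] is
    smooth on some neighbourhood of [p].  Three spaces are used: a manifold, its
    frame bundle, and the Swann bundle.  All local objects (functions, vector
    fields, frames) are total functions of which only the germ at a point
    matters. *)

Record germSpace (R : realType) := GermSpace {
  gpoint :> Type;
  nbh : gpoint -> set_system gpoint;
  smooth : gpoint -> set (gpoint -> R) }.

Arguments nbh {R} _ _.
Arguments smooth {R} _ _.

Section Generated.
Context {R : realType} (T : Type).
Variables (base : T -> set_system T) (gens : T -> set (T -> R)).

(* The structure generated by the local functions [gens u], as for a subset of
   R^N with its coordinate functions: the neighbourhoods are those of the
   initial topology (refining [base]), and the smooth functions are locally the
   smooth functions of finitely many generators. *)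
Definition gen_nbh (u : T) : set_system T := [set A |
  exists N (g : 'I_N -> T -> R) (e : R) (U : set T),
    [/\ forall i, gens u (g i), 0 < e, base u U &
        forall v, U v -> (forall i, `|g i v - g i u| < e) -> A v]].

Definition gen_smooth (u : T) : set (T -> R) := [set f |
  exists N (g : 'I_N -> T -> R) (F : 'rV[R]_N -> R),
    [/\ forall i, gens u (g i),
        smooth_near (\row_i g i u) F &
        gen_nbh u [set v | f v = F (\row_i g i v)]]].

Definition generated : germSpace R := GermSpace gen_nbh gen_smooth.

End Generated.

(** * Smooth manifolds *)

Record manifold (R : realType) (m : nat) := Manifold {
  mspace : topologicalType;
  chart : Type;
  cdom : chart -> set mspace;
  cmap : chart -> mspace -> 'rV[R]_m;
  cinv : chart -> 'rV[R]_m -> mspace;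
  cdom_open : forall c, open (cdom c);
  cmap_open : forall c, open (cmap c @` cdom c);
  cmapK : forall c p, cdom c p -> cinv c (cmap c p) = p;
  cmap_cont : forall c, {within cdom c, continuous (cmap c)};
  cinv_cont : forall c, {within cmap c @` cdom c, continuous (cinv c)};
  chart_cover : forall p, exists c, cdom c p;
  chart_compat : forall c c' p, cdom c p -> cdom c' p ->
    forall i, smooth_near (cmap c p) (fun x => cmap c' (cinv c x) 0 i);
  manifold_hausdorff : hausdorff_space mspace;
  manifold_second_countable : @second_countable mspace;
  manifold_connected : connected [set: mspace] }.

Definition manifold_germs (R : realType) (m : nat) (M : manifold R m) :
    germSpace R :=
  @GermSpace R (mspace M) (fun p => nbhs p)
    (fun p => [set f : mspace M -> R | exists c, cdom c p /\
                                 smooth_near (cmap c p) (f \o cinv c)]).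
Coercion manifold_germs : manifold >-> germSpace.

(** * Tangent vectors: derivations of the ring of germs of smooth functions *)

Section Tangent.
Context {R : realType} {T : germSpace R}.
Implicit Types p : T.

(* Derivations are extended by 0 to functions which are not smooth at p, so that
   equality of tangent vectors is equality of derivations of germs. *)
Definition is_derivation p (X : (T -> R) -> R) : Prop :=
  [/\ forall f, ~ smooth T p f -> X f = 0,
      forall f g, smooth T p f -> smooth T p g ->
        nbh T p [set q | f q = g q] -> X f = X g,
      forall (a : R) f g, smooth T p f -> smooth T p g ->
        X (a *: f + g) = a * X f + X g &
      forall f g, smooth T p f -> smooth T p g ->
        X (f * g) = X f * g p + f p * X g].

Definition derivation p : {pred ((T -> R) -> R^o)} :=
  fun X => `[< is_derivation p X >].

Lemma derivation_submod p : submod_closed (derivation p).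
Proof.
split.
  apply/asboolP; split => //= *.
  - by rewrite /GRing.zero /= mulr0 addr0.
  - by rewrite /GRing.zero /= mul0r mulr0 addr0.
move=> c X Y /asboolP[X0 Xl XD XM] /asboolP[Y0 Yl YD YM].
have E f : (c *: X + Y) f = c * X f + Y f by [].
apply/asboolP; split.
- by move=> f nf; rewrite E X0// Y0// mulr0 addr0.
- by move=> f g sf sg fg; rewrite !E (Xl _ _ sf sg fg) (Yl _ _ sf sg fg).
- move=> a f g sf sg; rewrite !E XD// YD//; ring.
- move=> f g sf sg; rewrite !E XM// YM//; ring.
Qed.

HB.instance Definition _ p :=
  GRing.isSubmodClosed.Build R ((T -> R) -> R^o) (derivation p)
    (derivation_submod p).

Record tangent p := Tangent {
  der :> (T -> R) -> R^o;
  derP : der \in derivation p }.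

HB.instance Definition _ p := [isSub for @der p].
HB.instance Definition _ p := [Choice of tangent p by <:].
HB.instance Definition _ p := [SubChoice_isSubLmodule of tangent p by <:].

(* The tangent vector acting as X on smooth germs (and the zero vector if X is
   not a derivation). *)
Definition mk_tangent p (X : (T -> R) -> R) : tangent p :=
  insubd 0 ((fun f => if `[< smooth T p f >] then X f else 0) :
              (T -> R) -> R^o).

(* velocity at time 0 of a curve with c 0 = p *)
Definition velocity p (c : R -> T) : tangent p :=
  mk_tangent p (fun f => derive1 (f \o c) 0).

Definition vfield := forall p, tangent p.

Definition smooth_vfield p (X : vfield) : Prop :=
  forall f, smooth T p f -> smooth T p (fun q => X q f).

Definition bracket (X Y : vfield) : vfield := fun p =>
  mk_tangent p (fun f => X p (fun q => Y q f) - Y p (fun q => X q f)).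

(** Differential forms.  A form on a distribution D (a field of subspaces; D =
    TT for ordinary forms) is represented by a form on T of which only the values
    on D matter: this is the restriction of the form to D. *)

Definition tdistribution := forall p, set (tangent p).
Definition TT : tdistribution := fun _ => setT.

Definition section_of (D : tdistribution) p (X : vfield) : Prop :=
  smooth_vfield p X /\ nbh T p [set q | D q (X q)].

Definition form1 := forall p, tangent p -> R.
Definition form2 := forall p, tangent p -> tangent p -> R.
Definition form3 := forall p, tangent p -> tangent p -> tangent p -> R.

Definition is_form1 (theta : form1) : Prop :=
  (forall p (a : R) x y, theta p (a *: x + y) = a * theta p x + theta p y) /\
  (forall p X, smooth_vfield p X -> smooth T p (fun q => theta q (X q))).

Definition is_form2 (D : tdistribution) (w : form2) : Prop :=
  [/\ forall p (a : R) x y z, D p x -> D p y -> D p z ->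
        w p (a *: x + y) z = a * w p x z + w p y z,
      forall p x y, D p x -> D p y -> w p x y = - w p y x &
      forall p X Y, section_of D p X -> section_of D p Y ->
        smooth T p (fun q => w q (X q) (Y q))].

Definition is_form3 (D : tdistribution) (eta : form3) : Prop :=
  [/\ forall p (a : R) x y z t, D p x -> D p y -> D p z -> D p t ->
        eta p (a *: x + y) z t = a * eta p x z t + eta p y z t,
      forall p x y z, D p x -> D p y -> D p z ->
        eta p x y z = - eta p y x z /\ eta p x y z = - eta p x z y &
      forall p X Y Z, section_of D p X -> section_of D p Y ->
        section_of D p Z ->
        smooth T p (fun q => eta q (X q) (Y q) (Z q))].

Definition nondegenerate_on (D : tdistribution) (w : form2) : Prop :=
  forall p x, D p x -> (forall y, D p y -> w p x y = 0) -> x = 0.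

(* The invariant formula for the exterior derivative of a 2-form, for fields
   with values in a distribution onto which pr projects. *)
Definition koszul (pr : forall p, tangent p -> tangent p) (w : form2)
    (X Y Z : vfield) (p : T) : R :=
  X p (fun q => w q (Y q) (Z q)) - Y p (fun q => w q (X q) (Z q))
  + Z p (fun q => w q (X q) (Y q))
  - w p (pr p (bracket X Y p)) (Z p) + w p (pr p (bracket X Z p)) (Y p)
  - w p (pr p (bracket Y Z p)) (X p).

(* The differential of the form w on D is the form eta on D. *)
Definition is_differential (D : tdistribution)
    (pr : forall p, tangent p -> tangent p) (w : form2) (eta : form3) : Prop :=
  is_form3 D eta /\
  forall p X Y Z, section_of D p X -> section_of D p Y -> section_of D p Z ->
    koszul pr w X Y Z p = eta p (X p) (Y p) (Z p).

Definition ext_d (w : form2) (eta : form3) : Prop :=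
  is_differential TT (fun _ => id) w eta.

Definition form3_0 : form3 := fun _ _ _ _ => 0.

Definition closed_form (w : form2) : Prop := ext_d w form3_0.

Definition lie_derivative (Z : vfield) (w : form2) (X Y : vfield) (p : T) : R :=
  Z p (fun q => w q (X q) (Y q)) - w p (bracket Z X p) (Y p)
  - w p (X p) (bracket Z Y p).

(** Endomorphism fields and affine connections *)

Definition endfield := forall p, tangent p -> tangent p.

Definition smooth_endfield p (A : endfield) : Prop :=
  forall X, smooth_vfield p X -> smooth_vfield p (fun q => A q (X q)).

(* [nabla p x Y] is the covariant derivative of Y along x; it is only
   meaningful when Y is smooth at p. *)
Definition covariant := forall p, tangent p -> vfield -> tangent p.

Definition is_connection (nabla : covariant) : Prop :=
  [/\ forall p (a : R) x y Y, smooth_vfield p Y ->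
        nabla p (a *: x + y) Y = a *: nabla p x Y + nabla p y Y,
      forall p x Y Y', smooth_vfield p Y -> smooth_vfield p Y' ->
        nabla p x (fun q => Y q + Y' q) = nabla p x Y + nabla p x Y',
      forall p (x : tangent p) f Y, smooth T p f -> smooth_vfield p Y ->
        nabla p x (fun q => f q *: Y q) = x f *: Y p + f p *: nabla p x Y,
      forall p x Y Y', smooth_vfield p Y -> smooth_vfield p Y' ->
        nbh T p [set q | Y q = Y' q] -> nabla p x Y = nabla p x Y' &
      forall p X Y, smooth_vfield p X -> smooth_vfield p Y ->
        smooth_vfield p (fun q => nabla q (X q) Y)].

Definition torsion_free (nabla : covariant) : Prop :=
  forall p X Y, smooth_vfield p X -> smooth_vfield p Y ->
    nabla p (X p) Y - nabla p (Y p) X = bracket X Y p.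

Definition parallel_form (nabla : covariant) (w : form2) : Prop :=
  forall p (x : tangent p) Y Z, smooth_vfield p Y -> smooth_vfield p Z ->
    x (fun q => w q (Y q) (Z q)) = w p (nabla p x Y) (Z p)
                                   + w p (Y p) (nabla p x Z).

(* the value at Y p of the covariant derivative of A along x *)
Definition nabla_end (nabla : covariant) p (x : tangent p) (A : endfield)
    (Y : vfield) : tangent p :=
  nabla p x (fun q => A q (Y q)) - A p (nabla p x Y).

End Tangent.

Arguments vfield {R} T.
Arguments tdistribution {R} T.
Arguments form1 {R} T.
Arguments form2 {R} T.
Arguments form3 {R} T.
Arguments endfield {R} T.
Arguments covariant {R} T.
Arguments TT {R} T p _.
Arguments form3_0 {R} T p _ _ _.

Section Maps.
Context {R : realType} {T T' : germSpace R}.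

(* the differential at u of a map phi smooth at u *)
Definition dmap (phi : T -> T') (u : T) (X : tangent u) : tangent (phi u) :=
  mk_tangent (phi u) (fun f => X (f \o phi)).

Definition pullback (phi : T -> T') (w : form2 T') : form2 T :=
  fun u X Y => w (phi u) (dmap phi X) (dmap phi Y).

End Maps.

(** * Quaternionic skew-Hermitian manifolds

    The frame index a : 'I_3 runs over 0, 1, 2 where the usual indices are 1, 2,
    3.  Addition in 'I_3 is modulo 3, so that the cyclic triples (a, b, c) are
    the triples (a, a + 1, a + 2). *)

Section Quaternionic.
Context {R : realType} {m : nat} (M : manifold R m).

Definition admissible (p : M) (I : 'I_3 -> tangent p -> tangent p) : Prop :=
  [/\ forall a (c : R) x y, I a (c *: x + y) = c *: I a x + I a y,
      forall a x, I a (I a x) = - x &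
      forall x, I 0 (I 1 (I 2 x)) = - x].

Definition endsubset := forall p : M, set (tangent p -> tangent p).

Definition admissible_frame (Q : endsubset) (p : M)
    (I : 'I_3 -> tangent p -> tangent p) : Prop :=
  admissible I /\
  forall A, Q p A <-> exists c : 'I_3 -> R, A = (fun x => \sum_a c a *: I a x).

Definition almost_quaternionic (Q : endsubset) : Prop :=
  forall p : M, exists J : 'I_3 -> endfield M,
    (forall a, smooth_endfield p (J a)) /\
    nbh M p [set q | admissible_frame Q (fun a => J a q)].

Record frame (Q : endsubset) (p : M) := Frame {
  fr :> 'I_3 -> tangent p -> tangent p;
  frP : admissible_frame Q fr }.

Definition scalar_2form (Q : endsubset) (w : form2 M) : Prop :=
  [/\ is_form2 (TT M) w, nondegenerate_on (TT M) w &
      forall p (I : frame Q p) a x y, w p (I a x) (I a y) = w p x y].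

Definition preserves (nabla : covariant M) (Q : endsubset) : Prop :=
  forall (p : M) (x : tangent p) (A : endfield M),
    smooth_endfield p A -> nbh M p [set q | Q q (A q)] ->
    exists2 B, Q p B &
      forall Y, smooth_vfield p Y -> nabla_end nabla x A Y = B (Y p).

(* (M, Q, w) is quaternionic skew-Hermitian, with connection nabla *)
Definition quaternionic_skew_Hermitian (Q : endsubset) (w : form2 M)
    (nabla : covariant M) : Prop :=
  [/\ almost_quaternionic Q, scalar_2form Q w &
      [/\ is_connection nabla, torsion_free nabla, preserves nabla Q &
          parallel_form nabla w]].

End Quaternionic.

(** * SO(3) and its action on frames *)

Section SO3.
Context {R : realType}.

Record SO3 := MkSO3 {
  so3 :> 'M[R]_3;
  so3_orth : so3^T *m so3 = 1%:M;
  so3_det : \det so3 = 1 }.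

(* The rotation exp (t ad e_a) of sp(1) = R e_1 + R e_2 + R e_3; the angle is
   2 t because [e_a, e_b] = 2 e_c. *)
Definition rot_mx (a : 'I_3) (t : R) : 'M[R]_3 := \matrix_(i, j)
  (if j == a then (i == a)%:R
   else if j == a + 1 then
     cos (2 * t) * (i == a + 1)%:R + sin (2 * t) * (i == a + 2)%:R
   else - sin (2 * t) * (i == a + 1)%:R + cos (2 * t) * (i == a + 2)%:R).

Lemma ord3P (P : 'I_3 -> Prop) : P 0 -> P 1 -> P 2 -> forall a, P a.
Proof.
move=> P0 P1 P2 [[|[|[|//]]] h].
- by rewrite (_ : Ordinal h = 0)//; exact: val_inj.
- by rewrite (_ : Ordinal h = 1)//; exact: val_inj.
- by rewrite (_ : Ordinal h = 2)//; exact: val_inj.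
Qed.

Lemma sum3 (V : zmodType) (F : 'I_3 -> V) : \sum_a F a = F 0 + F 1 + F 2.
Proof.
rewrite !big_ord_recl big_ord0 addr0 addrA.
by congr (F _ + F _ + F _); exact: val_inj.
Qed.

Lemma det3 (A : 'M[R]_3) : \det A =
  A 0 0 * (A 1 1 * A 2 2 - A 1 2 * A 2 1)
  - A 0 1 * (A 1 0 * A 2 2 - A 1 2 * A 2 0)
  + A 0 2 * (A 1 0 * A 2 1 - A 1 1 * A 2 0).
Proof.
rewrite (expand_det_row _ 0) sum3 /cofactor !(expand_det_row _ 0).
rewrite !big_ord_recl !big_ord0 /cofactor !det_mx11 !mxE /=.
have [B AE] : exists B : nat -> nat -> R, forall i j, A i j = B i j.
  by exists (fun i j => A (inord i) (inord j)) => i j; rewrite !inord_val.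
rewrite !AE /bump /= !modn_small //=; ring.
Qed.

Lemma rot_orth a t : (rot_mx a t)^T *m rot_mx a t = 1%:M.
Proof.
have cs := cos2Dsin2 (2 * t).
apply/matrixP; elim/ord3P : a => i j; elim/ord3P: i; elim/ord3P: j;
  rewrite !mxE sum3 !mxE /=; (ring || (rewrite -[RHS]cs; ring)).
Qed.

Lemma rot_det a t : \det (rot_mx a t) = 1.
Proof.
by rewrite -(cos2Dsin2 (2 * t)) det3; elim/ord3P : a; rewrite !mxE /=; ring.
Qed.

Definition rot a t : SO3 := MkSO3 (rot_orth a t) (rot_det a t).

Lemma SO3_col (A : SO3) i j :
  \sum_b A b i * A b j = (i == j)%:R.
Proof.
have /matrixP/(_ i j) := so3_orth A; rewrite !mxE => <-.
by apply: eq_bigr => b _; rewrite mxE.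
Qed.

Lemma SO3_row (A : SO3) i j :
  \sum_b A i b * A j b = (i == j)%:R.
Proof.
have /matrixP/(_ i j) := mulmx1C (so3_orth A); rewrite !mxE => <-.
by apply: eq_bigr => b _; rewrite mxE.
Qed.

(* the third column of a rotation is the cross product of the first two *)
Lemma SO3_cross (A : SO3) :
  [/\ A 1 0 * A 2 1 - A 2 0 * A 1 1 = A 0 2,
      A 2 0 * A 0 1 - A 0 0 * A 2 1 = A 1 2 &
      A 0 0 * A 1 1 - A 1 0 * A 0 1 = A 2 2].
Proof.
pose K : 'cV[R]_3 := \col_i
  (if i == 0 then A 1 0 * A 2 1 - A 2 0 * A 1 1
   else if i == 1 then A 2 0 * A 0 1 - A 0 0 * A 2 1
   else A 0 0 * A 1 1 - A 1 0 * A 0 1).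
have AK : A^T *m K = delta_mx 2 0.
  apply/matrixP => i j; rewrite ord1 !mxE sum3 !mxE /=.
  elim/ord3P : i => /=; [ring|ring|].
  by rewrite -[RHS](so3_det A) det3; ring.
have KE : K = col 2 A.
  by rewrite -[K]mul1mx -(mulmx1C (so3_orth A)) -mulmxA AK colE.
by split; [have /matrixP/(_ 0 0) := KE|have /matrixP/(_ 1 0) := KE|
  have /matrixP/(_ 2 0) := KE]; rewrite !mxE.
Qed.

End SO3.

Section FrameAction.
Context {R : realType} {m : nat} {M : manifold R m} {Q : endsubset M}.

(* the right action (I_1, I_2, I_3) |-> (I_1, I_2, I_3) A *)
Definition rotate (A : 'M[R]_3) (p : M) (I : 'I_3 -> tangent p -> tangent p) :
  'I_3 -> tangent p -> tangent p := fun c x => \sum_b A b c *: I b x.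

Lemma rotate_admissible (A : SO3) (p : M) (I : frame Q p) :
  admissible (rotate A I).
Proof.
have [[lin sq q3] _] := frP I.
have D a x y : I a (x + y) = I a x + I a y.
  by rewrite -[x]scale1r lin !scale1r.
have I0 a : I a 0 = 0 by apply: (addIr (I a 0)); rewrite -D !add0r.
have Z a c x : I a (c *: x) = c *: I a x.
  by rewrite -[c *: x]addr0 lin I0 addr0.
have N a x : I a (- x) = - I a x by rewrite -scaleN1r Z scaleN1r.
have I01 x : I 0 (I 1 x) = I 2 x.
  transitivity (I 0 (I 1 (- I 2 (I 2 x)))); first by rewrite sq opprK.
  by rewrite !N q3 opprK.
have I12 x : I 1 (I 2 x) = I 0 x.
  by rewrite -[LHS]opprK -(sq 0) !N q3 N opprK.
have I10 x : I 1 (I 0 x) = - I 2 x by rewrite -I12 sq.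
have I02 x : I 0 (I 2 x) = - I 1 x by rewrite -I01 sq.
have I21 x : I 2 (I 1 x) = - I 0 x by rewrite -I01 sq.
have I20 x : I 2 (I 0 x) = I 1 x by rewrite -I01 I10 N I02 opprK.
pose I' := rotate A I.
have E c d x : I' c (I' d x) =
    - ((\sum_b A b c * A b d) *: x)
    + (A 1 c * A 2 d - A 2 c * A 1 d) *: I 0 x
    + (A 2 c * A 0 d - A 0 c * A 2 d) *: I 1 x
    + (A 0 c * A 1 d - A 1 c * A 0 d) *: I 2 x.
  rewrite /I' /rotate !sum3 !D !Z !sq I01 I02 I10 I12 I20 I21.
  rewrite !scalerDr !scalerA !scalerN.
  rewrite [LHS](AC (3*3*3) ((1*5*9)*(6*8)*(7*3)*(2*4))).
  by rewrite !scalerDl !scaleNr !opprD.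
have sq' c x : I' c (I' c x) = - x.
  rewrite E SO3_col eqxx scale1r [A 1 c * _]mulrC [A 2 c * A 0 c]mulrC.
  by rewrite [A 0 c * A 1 c]mulrC !subrr !scale0r !addr0.
split=> //.
- move=> c k x y; rewrite /rotate scaler_sumr -big_split/=.
  apply: eq_bigr => b _.
  by rewrite lin scalerDr !scalerA [k * _]mulrC.
- move=> x; rewrite -[RHS](sq' 2) -/I'.
  have [c0 c1 c2] := SO3_cross A.
  rewrite E SO3_col /= scale0r oppr0 add0r c0 c1 c2.
  by rewrite [in RHS]/I' /rotate sum3.
Qed.

Lemma rotateP (A : SO3) (p : M) (I : frame Q p) :
  admissible_frame Q (rotate A I).
Proof.
split; first exact: rotate_admissible.
have [_ span] := frP I.
move=> B; rewrite span; split => -[c ->].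
- exists (fun a => \sum_e A e a * c e).
  apply/funext => x; rewrite /rotate.
  under [RHS]eq_bigr do rewrite scaler_sumr.
  rewrite exchange_big/=; apply: eq_bigr => b _.
  under eq_bigr do rewrite scalerA.
  rewrite -scaler_suml; congr (_ *: _).
  under eq_bigr do rewrite mulr_suml.
  rewrite exchange_big/= (bigD1 b)//= [X in _ + X]big1 ?addr0.
    under eq_bigr do rewrite mulrAC.
    by rewrite -mulr_suml SO3_row eqxx mul1r.
  move=> e eb; under eq_bigr do rewrite mulrAC.
  by rewrite -mulr_suml SO3_row (negbTE eb) mul0r.
- exists (fun b => \sum_a A b a * c a).
  apply/funext => x; rewrite /rotate.
  under eq_bigr do rewrite scaler_sumr.
  rewrite exchange_big/=; apply: eq_bigr => b _.
  rewrite scaler_suml; apply: eq_bigr => a _.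
  by rewrite scalerA mulrC.
Qed.

Definition frame_act (p : M) (I : frame Q p) (A : SO3) : frame Q p :=
  Frame (rotateP A I).

End FrameAction.

(** * The bundle S of admissible frames and the Swann bundle *)

Section Swann.
Context {R : realType} {m : nat} {M : manifold R m} (Q : endsubset M).

Definition frames := {p : M & frame Q p}.
Definition frames_proj (s : frames) : M := projT1 s.
Definition frames_fr (s : frames) :
    'I_3 -> tangent (frames_proj s) -> tangent (frames_proj s) :=
  fr (projT2 s).

(* The structure induced by the embedding of S in the vector bundle End(TM)^3:
   it is generated by the functions of the base point and by the matrix
   coefficients (I_a X) f of the endomorphisms. *)
Definition frame_bundle : germSpace R := @generated R frames
  (fun s => [set V | exists2 U, nbh M (frames_proj s) U &
                                V = frames_proj @^-1` U])
  (fun s => [set g |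
    (exists2 f, smooth M (frames_proj s) f & g = f \o frames_proj) \/
    (exists a (X : vfield M) f,
      [/\ smooth_vfield (frames_proj s) X, smooth M (frames_proj s) f &
          g = fun s' => frames_fr a (X (frames_proj s')) f])]).

Definition piS (s : frame_bundle) : M := frames_proj s.

Definition actS (A : SO3) (s : frame_bundle) : frame_bundle :=
  existT (frame Q) (projT1 s) (frame_act (projT2 s) A).

Definition sectionS (J : forall p : M, frame Q p) (p : M) : frame_bundle :=
  existT (frame Q) p (J p).

(* the fundamental vector field of e_a on S *)
Definition fundS (a : 'I_3) (s : frame_bundle) : tangent s :=
  velocity s (fun t => actS (rot a t) s).

(* theta = sum_a theta_a e_a is a connection form on S. The adjoint action of
   SO(3) on its Lie algebra sp(1) = R^3 is the standard one. *)
Definition connection_form (theta : 'I_3 -> form1 frame_bundle) : Prop :=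
  [/\ forall a, is_form1 (theta a),
      forall a b s, theta a s (fundS b s) = (a == b)%:R &
      forall (A : SO3) a s (X : tangent s),
        theta a (actS A s) (dmap (actS A) X) = \sum_b A b a * theta b s X].

(* theta is induced by nabla: Q is associated to S and the adjoint
   representation, so a local section J of S satisfies
   nabla J_e = sum_a (J^* theta_a) J_{[e_a, e]}, i.e., for cyclic (a, b, c),
   nabla J_b = 2 (J^* theta_a) J_c - 2 (J^* theta_c) J_a. *)
Definition induced_connection (nabla : covariant M)
    (theta : 'I_3 -> form1 frame_bundle) : Prop :=
  connection_form theta /\
  forall (J : forall p : M, frame Q p) (p : M) (x : tangent p) (Y : vfield M),
    (forall a, smooth_endfield p (fun q => J q a)) -> smooth_vfield p Y ->
    let th a := theta a (sectionS J p) (dmap (sectionS J) x) in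
    forall a, nabla_end nabla x (fun q => J q (a + 1)) Y =
      (2 * th a) *: J p (a + 2) (Y p) - (2 * th (a + 2)) *: J p a (Y p).

(* R_+ x S *)
Definition swann_bundle : germSpace R := @generated R ({posnum R} * frame_bundle)
  (fun u => [set V | exists2 U, nbh frame_bundle u.2 U & V = snd @^-1` U])
  (fun u => [set g | g = (fun v => v.1%:num) \/
    (exists2 f, smooth frame_bundle u.2 f & g = f \o snd)]).

Definition tcoord (u : swann_bundle) : R := u.1%:num.
Definition toS (u : swann_bundle) : frame_bundle := u.2.
Definition pihat (u : swann_bundle) : M := piS (toS u).

(* the right action of the structure group R_+ x SO(3) *)
Definition act (g : {posnum R} * SO3) (u : swann_bundle) : swann_bundle :=
  ((g.1%:num * u.1%:num)%:pos, actS g.2 u.2).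

Definition Z0 (u : swann_bundle) : tangent u :=
  velocity u (fun t => (((PosNum (expR_gt0 t))%:num * u.1%:num)%:pos, u.2) : swann_bundle).

Definition Za (a : 'I_3) (u : swann_bundle) : tangent u :=
  velocity u (fun t => (u.1, actS (rot a t) u.2) : swann_bundle).

Section Structure.
Variable theta : 'I_3 -> form1 frame_bundle.

(* the components of thetahat = t^-1 dt + theta *)
Definition thetahat0 (u : swann_bundle) (X : tangent u) : R :=
  (tcoord u)^-1 * X tcoord.

Definition thetahat (a : 'I_3) (u : swann_bundle) (X : tangent u) : R :=
  theta a (dmap toS X).

Definition vertical : tdistribution swann_bundle :=
  fun u => [set X | dmap pihat X = 0].

Definition horizontal : tdistribution swann_bundle :=
  fun u => [set X | thetahat0 X = 0 /\ forall a, thetahat a X = 0].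

(* the projection onto the horizontal distribution along the vertical one *)
Definition hproj (u : swann_bundle) (X : tangent u) : tangent u :=
  X - thetahat0 X *: Z0 u - \sum_a thetahat a X *: Za a u.

Definition hlift (u : swann_bundle) (x : tangent (pihat u)) : tangent u :=
  xget 0 [set X : tangent u | horizontal X /\ dmap pihat X = x].

(* Ihat_a, evaluated on X = thetahat_0(X) Z_0 + sum_i thetahat_i(X) Z_i +
   hproj X *)
Definition Ihat (a : 'I_3) (u : swann_bundle) (X : tangent u) : tangent u :=
  let b := a + 1 in let c := a + 2 in
  - (thetahat0 X *: Za a u) + thetahat a X *: Z0 u
  + thetahat b X *: Za c u - thetahat c X *: Za b u
  + hlift (frames_fr (s := toS u) a (dmap pihat (hproj X))).

Definition horizontal_form (w : form2 swann_bundle) : Prop :=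
  forall u X Y, vertical X -> w u X Y = 0.

Definition invariant_form (w : form2 swann_bundle) : Prop :=
  forall g u X Y, pullback (act g) w X Y = w u X Y.

Definition Hermitian_on (D : tdistribution swann_bundle)
    (w : form2 swann_bundle) : Prop :=
  forall a u X Y, D u X -> D u Y -> w u (Ihat a X) (Ihat a Y) = w u X Y.

End Structure.
End Swann.

(* Main.v *)
Require Import Defs.
From HB Require Import structures.
From mathcomp Require Import all_boot all_order all_algebra.
From mathcomp Require Import all_classical all_reals all_analysis.
From mathcomp Require Import ring lra.

Set Implicit Arguments.
Unset Strict Implicit.
Unset Printing Implicit Defensive.

Import Order.TTheory GRing.Theory Num.Theory.
Import numFieldNormedType.Exports.

Local Open Scope classical_set_scope.
Local Open Scope ring_scope.

(** Vector fields on the Swann bundle need not be projectable, so closedness cannot be pushed down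
    to [M] field by field. The Koszul expression is therefore expanded for arbitrary fields over the
    functions x_i o pi: the derivatives of the components of the fields cancel against the brackets,
    and only derivatives of the coefficients of omega remain.

    [S] is given by generators of its smooth germs and not by charts, so no dimension count bounds
    its vertical space. Instead the entries of the transition matrix from a local frame are
    recovered by a trace, which makes them smooth functions on [S]. They determine a vertical
    derivation, their derivatives at the identity form a skew matrix, and every skew 3 x 3 matrix is
    a combination of the matrices of ad e_a, that is, of the derivatives along the fundamental
    fields.

    In Hadamard's lemma G_i(x) is the integral over [0, 1] of (d_i F)(a + t (x - a)). Its smoothness
    is the real work: the integrals are given a weight t^k, which yields a family stable under
    partial derivatives. *)

(* The closedness of omega is the usual consequence of torsion-freeness and
   nabla omega = 0, checked on commuting coordinate fields; it passes to the
   pullback because d pi X = sum_i X(x_i o pi) d_i for every vector X of the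
   Swann bundle.  The differential d pi kills the fundamental fields, so
   omegahat does not see the projection along the vertical distribution.
   Non-degeneracy and the Hermitian property need d pi to be bijective from the
   horizontal space onto the tangent space of M: it is onto since every frame
   extends to a local section of S, and injective since the vertical tangent
   space is spanned by the fundamental fields.

   As tangent vectors are derivations of germs, all this rests on Hadamard's
   lemma F(x) = F(a) + sum_i (x_i - a_i) G_i(x), which yields the chain rule
   X(F(g_1, .., g_N)) = sum_i X(g_i) (d_i F)(g) for any derivation X. *)

(** * Calculus of smooth functions on R^N *)

Lemma nbhs_open (T : topologicalType) (x : T) (A : set T) : nbhs x A ->
  exists U, [/\ open U, U x & U `<=` A].
Proof. by rewrite nbhsE => -[U [oU Ux] UA]; exists U. Qed.

Section SmoothRN.
Context {R : realType}.

(** Replaces the little-o notation by one explicit estimate, for a derivative [L] guessed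
    beforehand; this is how [average] is differentiated. *)
Lemma differentiable_eps (V W : normedModType R) (f : V -> W) (x : V)
    (L : {linear V -> W}) : continuous L ->
  (forall e, 0 < e ->
     \forall h \near (0 : V), `|f (h + x) - f x - L h| <= e * `|h|) ->
  differentiable f x /\ 'd f x = L :> (V -> W).
Proof.
move=> cL Hf.
have E : f \o shift x = cst (f x) + L +o_ (0 : V) id.
  apply/eqaddoP => e e0; near=> h.
  rewrite !fctE opprD addrA; near: h; exact: Hf.
have dL := diff_unique cL E; split=> //.
by apply/diff_locallyP; rewrite dL.
Unshelve. all: by end_near. Qed.

Lemma near_eq_differentiable (V W : normedModType R) (f g : V -> W) (x : V) :
  (\forall y \near x, f y = g y) -> differentiable f x -> differentiable g x.
Proof.
move=> fg df; apply: (differentiable_eps (diff_continuous df) _).1.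
move=> e e0; rewrite -(nbhs_singleton fg).
have /eqaddoP/(_ e e0) := diff_locally df.
have : \forall h \near (0 : V), f (h + x) = g (h + x).
  by move: fg; rewrite (near_shift 0 x); apply: filterS => h; rewrite /= subr0.
by apply: filterS2 => h <-; rewrite !fctE opprD addrA.
Qed.

(** * Finite orders of differentiability on an open set *)

Section Ck.
Variable N : nat.
Implicit Types (U : set 'rV[R]_N) (F G : 'rV[R]_N -> R).

(** Stronger than C^k: the partial derivatives of order at most [k] are Frechet differentiable. The
    recursion exposes the derivative taken first, which suits the proofs of the product and chain
    rules by induction on [k]. *)
Fixpoint Ck (k : nat) U F : Prop :=
  (forall y, U y -> differentiable F y) /\
  (if k is k'.+1 then forall i, Ck k' U (partial i F) else True).

Lemma Ck_diff k U F y : Ck k U F -> U y -> differentiable F y.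
Proof. by case: k => [|k] [+ _]; apply. Qed.

Lemma CkW k U F : Ck k.+1 U F -> Ck k U F.
Proof. by elim: k F => [|k IH] F [dF pF]; split=> // i; exact/IH/pF. Qed.

Lemma CkS k U V F : U `<=` V -> Ck k V F -> Ck k U F.
Proof.
move=> UV; elim: k F => [|k IH] F [dF pF]; split=> //; do ?by move=> y /UV/dF.
by move=> i; exact/IH/pF.
Qed.

Lemma open_near_eq U F G y : open U -> {in U, F =1 G} -> U y ->
  \forall z \near y, F z = G z.
Proof.
move=> oU FG Uy; have := open_nbhs_nbhs (conj oU Uy).
by apply: filterS => z Uz; apply/FG/mem_set.
Qed.

Lemma eq_Ck k U F G : open U -> {in U, F =1 G} -> Ck k U F -> Ck k U G.
Proof.
move=> oU; elim: k F G => [|k IH] F G FG [dF pF]; split=> //;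
  do ?by move=> y Uy; apply: near_eq_differentiable (dF y Uy);
         exact: open_near_eq FG Uy.
move=> i; apply: IH (pF i) => y /set_mem Uy.
by apply: near_eq_derive; exact: open_near_eq FG Uy.
Qed.

Lemma Ck_cst k U c : Ck k U (fun=> c).
Proof.
elim: k c => [|k IH] c; split=> // i.
by rewrite (_ : partial i _ = fun=> 0)//; apply/funext=> y; exact: derive_cst.
Qed.

Lemma partial_coord i j (y : 'rV[R]_N) :
  partial i (fun z : 'rV[R]_N => z 0 j) y = (i == j)%:R.
Proof.
rewrite /partial.
have lin : linear (fun z : 'rV[R]_N => z 0 j : R) by move=> a u v; rewrite !mxE.
pose L : {linear 'rV[R]_N -> R} :=
  HB.pack (fun z : 'rV[R]_N => z 0 j : R) (GRing.isLinear.Build _ _ _ _ _ lin).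
have cL : continuous L by exact: coord_continuous.
rewrite -[LHS]/('D_('e_i) L y) deriveE; last exact: linear_differentiable.
by rewrite diff_lin //= mxE eqxx eq_sym.
Qed.

Lemma Ck_coord k U j : Ck k U (fun z : 'rV[R]_N => z 0 j).
Proof.
have dc y : differentiable (fun z : 'rV[R]_N => z 0 j : R) y.
  exact: differentiable_coord.
case: k => [|k]; split=> // i.
rewrite (_ : partial i _ = fun=> (i == j)%:R); first exact: Ck_cst.
by apply/funext => y; exact: partial_coord.
Qed.

Lemma CkD k U F G : open U -> Ck k U F -> Ck k U G -> Ck k U (F + G).
Proof.
move=> oU; elim: k F G => [|k IH] F G [dF pF] [dG pG]; split=> //;
  do ?by move=> y Uy; apply: differentiableD; [exact: dF|exact: dG].
move=> i; apply: eq_Ck (IH _ _ (pF i) (pG i)) => //= y /set_mem Uy.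
by apply/esym/deriveD; apply: diff_derivable; [exact: dF|exact: dG].
Qed.

Lemma CkM k U F G : open U -> Ck k U F -> Ck k U G -> Ck k U (F * G).
Proof.
move=> oU; elim: k F G => [|k IH] F G /[dup] sF [dF pF] /[dup] sG [dG pG];
  split=> //;
  do ?by move=> y Uy; apply: differentiableM; [exact: dF|exact: dG].
move=> i.
have := CkD oU (IH _ _ (CkW sF) (pG i)) (IH _ _ (CkW sG) (pF i)).
apply: eq_Ck => //= y /set_mem Uy.
by apply/esym/deriveM; apply: diff_derivable; [exact: dF|exact: dG].
Qed.

Lemma Ck_sum k U n (F : 'I_n -> 'rV[R]_N -> R) : open U ->
  (forall i, Ck k U (F i)) -> Ck k U (fun y => \sum_i F i y).
Proof.
move=> oU; elim: n F => [|n IH] F sF.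
  by rewrite (_ : (fun _ => _) = fun=> 0); [exact: Ck_cst|
    apply/funext => y; rewrite big_ord0].
rewrite (_ : (fun _ => _) = F ord0 + (fun y => \sum_i F (lift ord0 i) y)).
  by apply: CkD => //; exact: IH.
by apply/funext => y; rewrite big_ord_recl.
Qed.

End Ck.

Lemma row_sum n (G : 'I_n -> R) : \row_j G j = \sum_j G j *: 'e_j.
Proof.
rewrite [LHS]row_sum_delta; apply: eq_bigr => j _.
by rewrite mxE.
Qed.

Lemma differentiable_row (V : normedModType R) n (G : 'I_n -> V -> R) y :
  (forall j, differentiable (G j) y) ->
  differentiable (fun z => \row_j G j z) y /\
  forall v, 'd (fun z => \row_j G j z) y v = \row_j 'd (G j) y v.
Proof.
move=> dG.
have dr : differentiable (fun z => \row_j G j z) y.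
  rewrite (_ : (fun _ => _) = \sum_j (fun z => G j z *: 'e_j)).
    by apply: differentiable_sum => j; exact: differentiableZl.
  by apply/funext => z; rewrite row_sum fct_sumE.
split=> // v.
rewrite -deriveE// derive_mx; last exact: diff_derivable.
apply/rowP => j; rewrite !mxE -deriveE//; congr ('D_v _ y).
by apply/funext => z; rewrite mxE.
Qed.

Lemma partial_comp N n (F : 'rV[R]_n -> R) (G : 'I_n -> 'rV[R]_N -> R) y i :
  (forall j, differentiable (G j) y) -> differentiable F (\row_j G j y) ->
  differentiable (fun z => F (\row_j G j z)) y /\
  partial i (fun z => F (\row_j G j z)) y =
  \sum_j partial j F (\row_j G j y) * partial i (G j) y.
Proof.
move=> dG dF; have [dr rE] := differentiable_row dG.
have dFG : differentiable (F \o fun z => \row_j G j z) y.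
  exact: differentiable_comp.
split=> //; rewrite /partial deriveE// diff_comp//= rE [X in _ X = _]row_sum.
rewrite linear_sum/=.
by apply: eq_bigr => j _; rewrite linearZ !deriveE// mulrC.
Qed.

Lemma Ck_comp N n k (U : set 'rV[R]_N) (V : set 'rV[R]_n) F G :
  open U -> (forall y, U y -> V (\row_j G j y)) ->
  Ck k V F -> (forall j : 'I_n, Ck k U (G j)) ->
  Ck k U (fun z => F (\row_j G j z)).
Proof.
move=> oU UV; elim: k F => [|k IH] F /[dup] sF [dF pF] sG;
  have dFG y i (Uy : U y) := partial_comp i
     (fun j => Ck_diff (sG j) Uy) (dF _ (UV y Uy)).
- split=> // y Uy; apply: (differentiable_comp (f := fun z => \row_j G j z)).
    by apply: (differentiable_row _).1 => j; exact: Ck_diff (sG j) Uy.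
  exact/dF/UV.
- split=> [y Uy|i].
    apply: (differentiable_comp (f := fun z => \row_j G j z)).
      by apply: (differentiable_row _).1 => j; exact: Ck_diff (sG j) Uy.
    exact/dF/UV.
  apply: (@eq_Ck _ _ _
    (fun y => \sum_j partial j F (\row_j G j y) * partial i (G j) y)) => //.
    by move=> y /set_mem Uy; rewrite (dFG y i Uy).2.
  apply: Ck_sum => // j; apply: CkM => //; last exact: (sG j).2.
  by apply: IH => [|j']; [exact: pF|exact: CkW].
Qed.

Definition smooth_on N (U : set 'rV[R]_N) F := forall k, Ck k U F.

Lemma smooth_onE N (U : set 'rV[R]_N) F : smooth_on U F <->
  forall l y, U y -> differentiable (foldr partial F l) y.
Proof.
split=> [sF l y Uy|sF k].
  (* [foldr] applies the last index of [l] first, and this is the derivative that [Ck] removes: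
     hence the induction from the right end. *)
  elim/last_ind: l F sF => [|l i IH] F sF; first exact: Ck_diff (sF 0%N) Uy.
  by rewrite foldr_rcons; apply: IH => k; exact: (sF k.+1).2.
elim: k F sF => [|k IH] F sF; split=> //; do ?by move=> y; exact: (sF [::]).
by move=> i; apply: IH => l y; rewrite -foldr_rcons; exact: sF.
Qed.

Lemma smooth_nearP N (x : 'rV[R]_N) F : smooth_near x F <->
  exists U, [/\ open U, U x & smooth_on U F].
Proof.
split=> [|[U [oU Ux /smooth_onE sF]]].
  move=> /nbhs_open[U [oU Ux UF]].
  by exists U; split=> //; apply/smooth_onE => l y /UF.
by apply: filterS (open_nbhs_nbhs (conj oU Ux)) => y Uy l; exact: sF.
Qed.

(** * Germs of smooth functions on R^N *)

Section SmoothNear.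
Context {N : nat}.
Implicit Types (x : 'rV[R]_N) (F G : 'rV[R]_N -> R).

Lemma smooth_near_near x F : smooth_near x F ->
  \forall y \near x, smooth_near y F.
Proof. by move=> sF; apply: near_join; exact: sF. Qed.

Lemma smooth_near_diff x F : smooth_near x F -> differentiable F x.
Proof. by move=> /nbhs_singleton/(_ [::]). Qed.

Lemma smooth_near_partial x F i : smooth_near x F -> smooth_near x (partial i F).
Proof.
by apply: filterS => y sF l; rewrite -foldr_rcons; exact: sF.
Qed.

Lemma eq_smooth_near x F G : (\forall y \near x, F y = G y) ->
  smooth_near x F -> smooth_near x G.
Proof.
move=> /nbhs_open[V [oV Vx FG]] /smooth_nearP[U [oU Ux sF]].
have oUV : open (U `&` V) by exact: openI.
apply/smooth_nearP; exists (U `&` V); split=> // k.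
apply: (@eq_Ck _ _ _ F) => //; last exact: CkS (sF k).
by move=> y /set_mem[_ /FG].
Qed.

Lemma smooth_near_cst x c : smooth_near x (fun=> c).
Proof.
by apply/smooth_nearP; exists setT; split=> //; [exact: openT|move=> k; exact: Ck_cst].
Qed.

Lemma smooth_near_coord x j : smooth_near x (fun z : 'rV[R]_N => z 0 j).
Proof.
by apply/smooth_nearP; exists setT; split=> //; [exact: openT|move=> k; exact: Ck_coord].
Qed.

Lemma smooth_nearD x F G : smooth_near x F -> smooth_near x G ->
  smooth_near x (F + G).
Proof.
move=> /smooth_nearP[U [oU Ux sF]] /smooth_nearP[V [oV Vx sG]].
have oUV : open (U `&` V) by exact: openI.
apply/smooth_nearP; exists (U `&` V); split=> // k.
by apply: CkD => //; [exact: CkS (sF k)|exact: CkS (sG k)].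
Qed.

Lemma smooth_nearM x F G : smooth_near x F -> smooth_near x G ->
  smooth_near x (F * G).
Proof.
move=> /smooth_nearP[U [oU Ux sF]] /smooth_nearP[V [oV Vx sG]].
have oUV : open (U `&` V) by exact: openI.
apply/smooth_nearP; exists (U `&` V); split=> // k.
by apply: CkM => //; [exact: CkS (sF k)|exact: CkS (sG k)].
Qed.

End SmoothNear.

Lemma smooth_near_comp N n (x : 'rV[R]_N) (F : 'rV[R]_n -> R) G :
  (forall j, smooth_near x (G j)) -> smooth_near (\row_j G j x) F ->
  smooth_near x (fun z => F (\row_j G j z)).
Proof.
move=> sG /smooth_nearP[V [oV Vx sF]].
have cG : {for x, continuous (fun z => \row_j G j z)}.
  apply: differentiable_continuous; apply: (differentiable_row _).1 => j.
  exact: smooth_near_diff.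
have nV : \forall z \near x, V (\row_j G j z).
  by apply: cG; exact: open_nbhs_nbhs.
have : \forall z \near x, V (\row_j G j z) /\
   forall j l, differentiable (foldr partial (G j) l) z.
  have sG' := filter_forall (nbhs_filter x) sG.
  by apply: filterS2 nV sG'.
move=> /nbhs_open[U [oU Ux UH]].
apply/smooth_nearP; exists U; split=> // k.
apply: (Ck_comp oU _ (sF k)) => [y /UH[]//|j].
have /smooth_onE/(_ k) // : forall l y, U y -> differentiable (foldr partial (G j) l) y.
by move=> l y /UH[_ /(_ j)].
Qed.

End SmoothRN.

(** * Hadamard's lemma *)

Section Integral01.
Context {R : realType}.
Implicit Types f g : R -> R.

(** Two-sided continuity in [R], ends of the segment included. The integrands below are defined
    beyond the segment, and this form passes to sums and products without subspace topologies. *)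
Definition cont01 f := forall t, t \in `[0, 1] -> {for t, continuous f}.

Definition int01 f : R := \int[@lebesgue_measure R]_(t in `[0, 1]) f t.

Lemma cont01_integrable f : cont01 f ->
  (@lebesgue_measure R).-integrable `[0, 1] (EFin \o f).
Proof.
move=> cf; apply: continuous_compact_integrable; first exact: segment_compact.
by apply: continuous_in_subspaceT => t /set_mem; exact: cf.
Qed.

Lemma cont01_cst (c : R) : cont01 (fun=> c).
Proof. by move=> t _; exact: cvg_cst. Qed.

Lemma cont01D f g : cont01 f -> cont01 g -> cont01 (fun t => f t + g t).
Proof. by move=> cf cg t t01; apply: cvgD; [exact: cf|exact: cg]. Qed.

Lemma cont01Z (c : R) f : cont01 f -> cont01 (fun t => c * f t).
Proof. by move=> cf t t01; apply: cvgM; [exact: cvg_cst|exact: cf]. Qed.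

Lemma int01D f g : cont01 f -> cont01 g ->
  int01 (fun t => f t + g t) = int01 f + int01 g.
Proof.
by move=> cf cg; apply: RintegralD => //; exact: cont01_integrable.
Qed.

Lemma int01Z c f : cont01 f -> int01 (fun t => c * f t) = c * int01 f.
Proof. by move=> cf; apply: RintegralZl => //; exact: cont01_integrable. Qed.

Lemma int01_cst (c : R) : int01 (fun=> c) = c.
Proof.
by rewrite /int01 Rintegral_cst//= lebesgue_measure_itv/= lte_fin ltr01
  oppr0 adde0 mulr1.
Qed.

Lemma cont01_sum n (f : 'I_n -> R -> R) : (forall i, cont01 (f i)) ->
  cont01 (fun t => \sum_i f i t).
Proof.
elim: n f => [|n IH] f cf.
  rewrite (_ : (fun _ => _) = fun=> 0); first exact: cont01_cst.
  by apply/funext => t; rewrite big_ord0.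
rewrite (_ : (fun _ => _) = fun t => f ord0 t + \sum_i f (lift ord0 i) t).
  by apply: cont01D => //; exact: IH.
by apply/funext => t; rewrite big_ord_recl.
Qed.

Lemma int01_sum n (f : 'I_n -> R -> R) : (forall i, cont01 (f i)) ->
  int01 (fun t => \sum_i f i t) = \sum_i int01 (f i).
Proof.
elim: n f => [|n IH] f cf.
  rewrite (_ : (fun _ => _) = fun=> 0); first by rewrite int01_cst big_ord0.
  by apply/funext => t; rewrite big_ord0.
rewrite (_ : (fun _ => _) = fun t => f ord0 t + \sum_i f (lift ord0 i) t).
  rewrite int01D//; last exact: cont01_sum.
  by rewrite IH// big_ord_recl.
by apply/funext => t; rewrite big_ord_recl.
Qed.

Lemma int01_le f c : cont01 f -> (forall t, t \in `[0, 1] -> `|f t| <= c) ->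
  `|int01 f| <= c.
Proof.
move=> cf fc; apply: le_trans (le_normr_Rintegral _ _) _ => //.
  exact: cont01_integrable.
rewrite -[leRHS]int01_cst; apply: le_Rintegral => //.
- apply: cont01_integrable => t t01.
  by apply: (cvg_norm (T := R)); exact: cf.
- apply: (@cont01_integrable (fun=> c)); exact: cont01_cst.
Qed.

End Integral01.

Lemma near0_lt (R : realType) (V : normedModType R) (e : R) : 0 < e ->
  \forall h \near (0 : V), `|h| < e.
Proof.
move=> e0; apply/nbhs_ballP; exists e => // h.
by rewrite -ball_normE/= sub0r normrN.
Qed.

(** * Averages along rays and Hadamard quotients *)

Section Hadamard.
Context {R : realType} {N : nat}.
Variables (a : 'rV[R]_N) (r : R).
Hypothesis r0 : 0 < r.
Implicit Types (F : 'rV[R]_N -> R) (x y z w : 'rV[R]_N).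

(** Functions are smooth on the open ball [U]. The smaller closed ball [K] is compact, which bounds
    their derivatives, and convex, which keeps the segments of the mean value theorem inside. *)
Let U : set 'rV[R]_N := ball a (r + r).
Let K : set 'rV[R]_N := [set y | `|y - a| <= r].

Let oU : open U. Proof. exact: ball_open. Qed.

Let KU : K `<=` U.
Proof.
move=> y /= ya; rewrite /U -ball_normE /= distrC (le_lt_trans ya)//.
by rewrite ltrDl.
Qed.

Let K_bounded F : (forall y, U y -> differentiable F y) ->
  exists2 C : R, 0 <= C & forall y, K y -> `|F y| <= C.
Proof.
move=> dF.
have cK : compact K.
  apply: bounded_closed_compact.
    exists (r + `|a|); split; first exact: num_real.
    move=> M rM y /= ya; apply: ltW; apply: le_lt_trans rM.
    by rewrite -[y](subrK a) (le_trans (ler_normD _ _))// lerD2r.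
  rewrite (_ : K = closed_ball a r); first exact: closed_closure.
  rewrite closed_ballE//; apply/seteqP; split=> y /=;
    by rewrite /closed_ball_ /= distrC.
have /compact_bounded[M [_ MF]] : compact (F @` K).
  apply: continuous_compact => //; apply: continuous_in_subspaceT => y /set_mem.
  by move=> /KU/dF/differentiable_continuous.
exists (`|M| + 1) => [|y Ky]; first by rewrite addr_ge0.
by apply: MF; [rewrite (le_lt_trans (ler_norm _))// ltrDl|exists y].
Qed.

Let convK z w (s : R) : K z -> K w -> s \in `[0, 1] -> K (s *: (w - z) + z).
Proof.
move=> zK wK /itvP s01; rewrite /K /=.
rewrite (_ : _ - a = s *: (w - a) + (1 - s) *: (z - a)); last first.
  rewrite scalerBl scale1r !scalerBr opprB addrA.
  apply/rowP => i; rewrite !mxE; ring.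
apply: le_trans (ler_normD _ _) _; rewrite !normrZ.
rewrite !ger0_norm ?subr_ge0 ?s01//.
rewrite (_ : r = s * r + (1 - s) * r); last ring.
by apply: lerD; apply: ler_wpM2l; rewrite ?subr_ge0 ?s01.
Qed.

Lemma diffE_partial F y v : differentiable F y ->
  'd F y v = \sum_i v 0 i * partial i F y.
Proof.
move=> dF; rewrite {1}[v]row_sum_delta linear_sum/=.
by apply: eq_bigr => i _; rewrite linearZ /partial deriveE.
Qed.

Let line_derive F z v (s : R) : differentiable F (s *: v + z) ->
  is_derive s 1 (fun t : R => F (t *: v + z)) ('d F (s *: v + z) v).
Proof.
move=> dF.
have dl : is_diff s (fun t : R => t *: v + z) (fun t => t *: v).
  have dl : is_diff s (( *:%R^~ v) + cst z) (( *:%R^~ v) + 0) by exact: is_diffD.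
  by apply: is_diff_eq dl _; rewrite addr0.
have dd : is_diff s (F \o (fun t : R => t *: v + z))
   ('d F (s *: v + z) \o (fun t => t *: v)).
  have := @is_diff_comp _ _ _ _ _ _ _ _ _ dl (differentiableP dF).
  exact.
have d1 : differentiable (F \o (fun t : R => t *: v + z)) s by exact: ex_diff.
apply: DeriveDef; first exact: diff_derivable.
by rewrite deriveE// diff_val/= scale1r.
Qed.

Let coord_le x i : `|x 0 i| <= `|x|.
Proof.
rewrite [leRHS]/Num.Def.normr/= mx_normrE.
exact: (le_bigmax _ (fun ij => `|x ij.1 ij.2|) (0, i)).
Qed.

Let mean_value F z w : (forall y, U y -> differentiable F y) -> K z -> K w ->
  exists2 c : R, c \in `[0, 1] &
    F w - F z = \sum_i (w - z) 0 i * partial i F (c *: (w - z) + z).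
Proof.
move=> dF Kz Kw.
pose g (t : R) := F (t *: (w - z) + z).
have dg (t : R) : t \in `[0, 1] -> is_derive t 1 g ('d F (t *: (w - z) + z) (w - z)).
  by move=> t01; apply: line_derive; apply/dF/KU/convK.
have dg' (t : R) : t \in `]0, 1[ ->
    is_derive t 1 g ('d F (t *: (w - z) + z) (w - z)).
  by move=> t01; apply: dg; exact: subset_itv_oo_cc t01.
have gc : {within `[0, 1], continuous g}.
  apply: continuous_in_subspaceT => t /set_mem t01.
  have [dgt _] := dg t t01.
  by apply: differentiable_continuous; exact/derivable1_diffP.
have [c c01] := MVT_segment (ler01 : 0 <= 1 :> R) dg' gc.
rewrite /g scale1r scale0r add0r subrK subr0 mulr1 => ->.
by exists c => //; rewrite diffE_partial//; exact/dF/KU/convK.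
Qed.

Let lipschitz F : smooth_on U F ->
  exists2 C : R, 0 <= C & forall z w, K z -> K w -> `|F w - F z| <= C * `|w - z|.
Proof.
move=> sF.
have dF y : U y -> differentiable F y by exact: (Ck_diff (sF 0%N)).
have B i : exists C : R, 0 <= C /\ forall y, K y -> `|partial i F y| <= C.
  have [C C0 CF] := @K_bounded (partial i F) ((sF 1%N).2 i).1.
  by exists C.
have [C HC] := choice B.
exists (\sum_i C i) => [|z w Kz Kw].
  by apply: sumr_ge0 => i _; exact: (HC i).1.
have [c c01 ->] := mean_value dF Kz Kw.
apply: le_trans (ler_norm_sum _ _ _) _; rewrite mulr_suml; apply: ler_sum => i _.
rewrite normrM mulrC; apply: ler_pM => //.
by apply: (HC i).2; exact: convK.
Qed.

Lemma smooth_on_partial F i : smooth_on U F -> smooth_on U (partial i F).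
Proof. by move=> sF k; exact: (sF k.+1).2. Qed.

(** The mean value theorem, with Lipschitz constants for the partial derivatives. The constant is
    uniform in [z] and [w], so the estimate can be integrated along a ray. *)
Let taylor F : smooth_on U F -> exists2 C : R, 0 <= C &
  forall z w, K z -> K w ->
    `|F w - F z - \sum_i (w - z) 0 i * partial i F z| <= C * `|w - z| ^+ 2.
Proof.
move=> sF.
have dF y : U y -> differentiable F y by exact: (Ck_diff (sF 0%N)).
have B i : exists C : R, 0 <= C /\
   forall z w, K z -> K w -> `|partial i F w - partial i F z| <= C * `|w - z|.
  by have [C C0 CF] := lipschitz (smooth_on_partial i sF); exists C.
have [C HC] := choice B.
exists (\sum_i C i) => [|z w Kz Kw].
  by apply: sumr_ge0 => i _; exact: (HC i).1.
have [c c01 ->] := mean_value dF Kz Kw.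
rewrite -sumrB; apply: le_trans (ler_norm_sum _ _ _) _.
rewrite mulr_suml; apply: ler_sum => i _.
rewrite -mulrBr normrM [leRHS](_ : _ = `|w - z| * (C i * `|w - z|)); last ring.
apply: ler_pM => //.
apply: le_trans ((HC i).2 _ _ Kz (convK Kz Kw c01)) _.
rewrite addrK normrZ; apply: ler_wpM2l; first exact: (HC i).1.
by rewrite ler_piMl// ger0_norm (itvP c01).
Qed.

(** The weight [t ^+ k] is there because each derivative in [x] brings out a factor [t]: the partial
    derivatives of a weighted average are again weighted averages, with [k] raised by 1. *)
Definition ray k F x : R -> R := fun t => t ^+ k * F (t *: (x - a) + a).

Definition average k F x : R := int01 (ray k F x).

Let Ka : K a. Proof. by rewrite /K /= subrr normr0 ltW. Qed.

Let ray_cont k F x : smooth_on U F -> K x -> cont01 (ray k F x).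
Proof.
move=> sF Kx t t01; apply: cvgM; first exact: exprn_continuous.
have dF : differentiable F (t *: (x - a) + a).
  by apply: Ck_diff (sF 0%N) _; exact/KU/convK.
have [dt _] := line_derive dF.
by apply: (differentiable_continuous (f := fun t : R => F (t *: (x - a) + a)));
  exact/derivable1_diffP.
Qed.

(** Differentiation under the integral sign. The quadratic remainder of [taylor] is simply
    integrated, so no limit has to be exchanged with the integral. *)
Let average_diff k F x : smooth_on U F -> `|x - a| < r ->
  differentiable (average k F) x /\
  forall i, partial i (average k F) x = average k.+1 (partial i F) x.
Proof.
move=> sF xr.
have Kx : K x by exact: ltW.
pose l i := average k.+1 (partial i F) x.
have lin : linear (fun h : 'rV[R]_N => \sum_i h 0 i * l i).
  move=> c u v; rewrite scaler_sumr -big_split; apply: eq_bigr => i _ /=.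
  by rewrite !mxE mulrDl /GRing.scale/= mulrA.
pose L : {linear 'rV[R]_N -> R} :=
  HB.pack (fun h : 'rV[R]_N => \sum_i h 0 i * l i)
    (GRing.isLinear.Build _ _ _ _ _ lin).
have cL : continuous L.
  move=> h; apply: differentiable_continuous.
  have : Ck 0 setT L.
    apply: Ck_sum openT _ => i.
    exact: (CkM openT (Ck_coord _ _ i) (Ck_cst _ _ (l i))).
  by move/Ck_diff; exact.
have [C C0 FC] := taylor sF.
have est h : K (h + x) ->
   `|average k F (h + x) - average k F x - L h| <= C * `|h| ^+ 2.
  move=> Khx.
  have -> : average k F (h + x) - average k F x - L h =
    int01 (fun t => ray k F (h + x) t + ((-1) * ray k F x t +
       (-1) * \sum_i h 0 i * ray k.+1 (partial i F) x t)).
    have cs : cont01 (fun t => \sum_i h 0 i * ray k.+1 (partial i F) x t).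
      apply: cont01_sum => i; apply: cont01Z.
      exact: ray_cont (smooth_on_partial i sF) _.
    have c1 : cont01 (ray k F x) by exact: ray_cont.
    rewrite int01D; [|exact: ray_cont|by apply: cont01D; exact: cont01Z].
    rewrite int01D; [|exact: cont01Z|exact: cont01Z].
    rewrite !int01Z// !mulN1r addrA; congr (_ - _).
    rewrite /L/= int01_sum => [|i].
      apply: eq_bigr => i _; rewrite int01Z//.
      exact: ray_cont (smooth_on_partial i sF) _.
    by apply: cont01Z; exact: ray_cont (smooth_on_partial i sF) _.
  apply: int01_le => [|t t01].
    apply: cont01D; first exact: ray_cont.
    apply: cont01D; first by apply: cont01Z; exact: ray_cont.
    apply: cont01Z; apply: cont01_sum => i.
    apply: cont01Z; exact: ray_cont (smooth_on_partial i sF) _.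
  have := FC _ _ (convK Ka Kx t01) (convK Ka Khx t01).
  set z := t *: (x - a) + a; set w := t *: (h + x - a) + a.
  have wz : w - z = t *: h.
    by rewrite /w /z; apply/rowP => i; rewrite !mxE; ring.
  rewrite wz => Fwz.
  rewrite (_ : ray _ _ _ _ + _ =
    t ^+ k * (F w - F z - \sum_i (t *: h) 0 i * partial i F z)); last first.
    rewrite /ray -/z -/w mulrBr mulrBr !mulN1r addrA; congr (_ - _).
    rewrite mulr_sumr; apply: eq_bigr => i _; rewrite !mxE exprS; ring.
  rewrite normrM.
  have t0 : 0 <= t by rewrite (itvP t01).
  have t1 : t <= 1 by rewrite (itvP t01).
  apply: (@le_trans _ _ (1 * (C * `|h| ^+ 2))); last by rewrite mul1r.
  apply: ler_pM => //.
    by rewrite normrX ger0_norm// exprn_ile1.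
  apply: le_trans Fwz _; apply: ler_wpM2l => //.
  rewrite normrZ ger0_norm// exprMn ler_piMl ?exprn_ge0//.
  by rewrite exprn_ile1.
have [dA dE] : differentiable (average k F) x /\ 'd (average k F) x = L :> (_ -> _).
  apply: differentiable_eps cL _ => e e0.
  near=> h.
  apply: le_trans (est h _) _.
    rewrite /K/= -addrA (le_trans (ler_normD _ _))// -lerBrDr ltW//.
    by near: h; apply: (@near0_lt _ 'rV[R]_N); rewrite subr_gt0.
  rewrite expr2 mulrA ler_wpM2r//.
  (* Adding 1 keeps the denominator positive when [C] is 0. *)
  have /ltW hle : `|h| < e / (C + 1).
    by near: h; apply: (@near0_lt _ 'rV[R]_N); rewrite divr_gt0// ltr_wpDl.
  apply: le_trans (ler_wpM2l C0 hle) _.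
  rewrite mulrCA ger_pMr// ler_pdivrMr ?ltr_wpDl//.
  by rewrite mul1r lerDl.
split=> // i; rewrite /partial deriveE// dE /L/= (bigD1 i)//= big1 => [|j ji].
  by rewrite mxE !eqxx mul1r addr0.
by rewrite mxE eqxx/= (negbTE ji) mul0r.
Unshelve. all: by end_near. Qed.

Lemma average_smooth k F : smooth_on U F -> smooth_near a (average k F).
Proof.
move=> sF; apply/smooth_nearP; exists (ball a r); split.
- exact: ball_open.
- exact: ballxx.
have B x : ball a r x -> `|x - a| < r by rewrite -ball_normE /= distrC.
move=> n; elim: n k F sF => [|n IH] k F sF; split=> //;
  do ?by move=> x /B xr; exact: (average_diff k sF xr).1.
move=> i; apply: eq_Ck (IH k.+1 _ (smooth_on_partial i sF)) => //.
  exact: ball_open.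
by move=> x /set_mem/B xr; rewrite (average_diff k sF xr).2.
Qed.

(** The fundamental theorem of calculus for t |-> F(a + t (x - a)) on [0, 1]; the coordinates of
    [x - a] come out of the integral. *)
Lemma average_hadamard F x : smooth_on U F -> `|x - a| < r ->
  F x = F a + \sum_i (x 0 i - a 0 i) * average 0 (partial i F) x.
Proof.
move=> sF xr; have Kx : K x by exact: ltW.
pose g (t : R) := F (t *: (x - a) + a).
pose dg t := \sum_i (x 0 i - a 0 i) * ray 0 (partial i F) x t.
have c1 : cont01 dg.
  apply: cont01_sum => i; apply: cont01Z.
  exact: ray_cont (smooth_on_partial i sF) _.
have gd (t : R) : t \in `[0, 1] -> is_derive t 1 g (dg t).
  move=> t01.
  have dF : differentiable F (t *: (x - a) + a).
    by apply: Ck_diff (sF 0%N) _; exact/KU/convK.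
  apply: is_derive_eq (line_derive dF) _.
  rewrite diffE_partial//; apply: eq_bigr => i _.
  by rewrite /ray expr0 mul1r !mxE.
have gc (t : R) : t \in `[0, 1] -> {for t, continuous g}.
  move=> /gd[gt _]; apply: differentiable_continuous; exact/derivable1_diffP.
have : (\int[@lebesgue_measure R]_(t in `[0%R, 1%R]) (dg t)%:E =
        (g 1)%:E - (g 0)%:E)%E.
  apply: continuous_FTC2 => //.
  - by apply: continuous_in_subspaceT => t /set_mem; exact: c1.
  - split.
    + by move=> t /subset_itv_oo_cc /gd[].
    + by apply: cvg_at_right_filter; apply: gc; rewrite bound_itvE.
    + by apply: cvg_at_left_filter; apply: gc; rewrite bound_itvE.
  - by move=> t /subset_itv_oo_cc /gd gt; rewrite derive1E derive_val.
move=> /(congr1 fine) /= E.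
have {}E : int01 dg = g 1 - g 0 by rewrite -E.
move: E; rewrite /g scale1r scale0r add0r subrK => E.
rewrite -[LHS](subrK (F a)) -E addrC; congr (_ + _).
rewrite int01_sum => [|i].
  apply: eq_bigr => i _; rewrite int01Z//.
  exact: ray_cont (smooth_on_partial i sF) _.
apply: cont01Z; exact: ray_cont (smooth_on_partial i sF) _.
Qed.

Lemma average_center F : average 0 F a = F a.
Proof.
rewrite -[RHS]int01_cst; congr int01; apply/funext => t.
by rewrite /ray expr0 mul1r subrr scaler0 add0r.
Qed.

End Hadamard.

Lemma hadamard (R : realType) N (a : 'rV[R]_N) F : smooth_near a F ->
  exists G : 'I_N -> 'rV[R]_N -> R,
    [/\ forall i, smooth_near a (G i), forall i, G i a = partial i F a &
        \forall x \near a, F x = F a + \sum_i (x 0 i - a 0 i) * G i x].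
Proof.
move=> /smooth_nearP[V [oV Va sF]].
have /nbhs_ballP[e /= e0 eV] := open_nbhs_nbhs (conj oV Va).
(* Halved because smoothness is required on the ball of radius [r + r]. *)
have r0 : 0 < e / 2 by exact: divr_gt0.
have {}sF : smooth_on (ball a (e / 2 + e / 2)) F.
  by move=> k; apply: CkS (sF k); rewrite -splitr.
exists (fun i => average a 0 (partial i F)); split.
- by move=> i; exact: (average_smooth r0 0 (smooth_on_partial i sF)).
- by move=> i; exact: average_center.
- apply/nbhs_ballP; exists (e / 2) => // x; rewrite -ball_normE/= distrC => xa.
  exact: (average_hadamard r0 sF).
Qed.

(** * Derivations on germ spaces *)

(** A [germSpace] carries no axioms; these are the ones that the calculus of derivations uses.
    [smooth_comp] alone gives constants (no argument), invariance under equality of germs (one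
    argument), sums and products (two arguments). *)
Record regular (R : realType) (T : germSpace R) : Prop := Regular {
  nbh_filter : forall p, Filter (nbh T p);
  nbh_self : forall p A, nbh T p A -> A p;
  nbh_nbh : forall p A, nbh T p A -> nbh T p [set q | nbh T q A];
  smooth_nbh : forall p f, smooth T p f -> nbh T p [set q | smooth T q f];
  smooth_comp : forall p N (g : 'I_N -> T -> R) (F : 'rV[R]_N -> R) f,
    (forall i, smooth T p (g i)) -> smooth_near (\row_i g i p) F ->
    nbh T p [set q | f q = F (\row_i g i q)] -> smooth T p f;
  smooth_cont : forall p f e, smooth T p f -> 0 < e ->
    nbh T p [set q | `|f q - f p| < e] }.

Section Regular.
Context {R : realType} {T : germSpace R}.
Hypothesis rT : regular T.
Implicit Types (p q : T) (f g : T -> R).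

Lemma nbhS p (A B : set T) : A `<=` B -> nbh T p A -> nbh T p B.
Proof. by have := nbh_filter rT p => ?; exact: filterS. Qed.

Lemma nbhI p (A B : set T) : nbh T p A -> nbh T p B -> nbh T p (A `&` B).
Proof. by have := nbh_filter rT p => ?; exact: filterI. Qed.

Lemma nbhT p (A : set T) : (forall q, A q) -> nbh T p A.
Proof.
move=> AT; have FF := nbh_filter rT p.
by apply: (@nbhS _ setT) => [q _ //|]; exact: filterT.
Qed.

Lemma nbh_forall p (I : finType) (A : I -> set T) :
  (forall i, nbh T p (A i)) -> nbh T p [set q | forall i, A i q].
Proof. by move=> pA; exact: (filter_forall (nbh_filter rT p)). Qed.

Lemma smooth_row p N (g : 'I_N -> T -> R) (A : set 'rV[R]_N) :
  (forall i, smooth T p (g i)) -> nbhs (\row_i g i p) A ->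
  nbh T p [set q | A (\row_i g i q)].
Proof.
move=> sg /nbhs_ballP[e /= e0 eA].
apply: nbhS (nbh_forall (fun i => smooth_cont rT (sg i) e0)) => q /= qe.
apply: eA; split=> // i j; rewrite !mxE /ball/= distrC; exact: qe.
Qed.

Lemma eq_smooth p f g : nbh T p [set q | f q = g q] ->
  smooth T p f -> smooth T p g.
Proof.
move=> fg sf; apply: (smooth_comp rT (g := fun _ : 'I_1 => f)
    (F := fun x => x 0 ord0) (fun=> sf)); first exact: smooth_near_coord.
by apply: nbhS fg => q /= <-; rewrite mxE.
Qed.

Lemma smooth_cst p c : smooth T p (fun=> c).
Proof.
apply: (smooth_comp rT (g := fun (_ : 'I_0) (_ : T) => 0) (F := fun=> c)).
- by case.
- exact: smooth_near_cst.
- exact: nbhT.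
Qed.

Let smooth2 p f g (F : 'rV[R]_2 -> R) h : smooth T p f -> smooth T p g ->
  (forall x, smooth_near x F) ->
  (forall q, h q = F (\row_i (if i == ord0 then f else g) q)) -> smooth T p h.
Proof.
move=> sf sg sF hE.
apply: (smooth_comp rT (g := fun i : 'I_2 => if i == ord0 then f else g) (F := F)).
- by move=> i; case: ifP.
- exact: sF.
- exact: nbhT.
Qed.

Lemma smoothD p f g : smooth T p f -> smooth T p g -> smooth T p (f + g).
Proof.
move=> sf sg; apply: (smooth2 (F := (fun x => x 0 ord0) + (fun x => x 0 ord_max)) sf sg).
  by move=> x; apply: smooth_nearD; exact: smooth_near_coord.
by move=> q; rewrite !fctE !mxE.
Qed.

Lemma smoothM p f g : smooth T p f -> smooth T p g -> smooth T p (f * g).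
Proof.
move=> sf sg; apply: (smooth2 (F := (fun x => x 0 ord0) * (fun x => x 0 ord_max)) sf sg).
  by move=> x; apply: smooth_nearM; exact: smooth_near_coord.
by move=> q; rewrite !fctE !mxE.
Qed.

Lemma smoothZ p (a : R) f : smooth T p f -> smooth T p (a *: f).
Proof. by move=> sf; exact: (smoothM (smooth_cst p a) sf). Qed.

Lemma smoothN p f : smooth T p f -> smooth T p (- f).
Proof. by rewrite -scaleN1r; exact: smoothZ. Qed.

Lemma smooth_sum p n (f : 'I_n -> T -> R) : (forall i, smooth T p (f i)) ->
  smooth T p (fun q => \sum_i f i q).
Proof.
elim: n f => [|n IH] f sf.
  apply: eq_smooth (smooth_cst p 0); apply: nbhT => q /=.
  by rewrite big_ord0.
apply: eq_smooth (smoothD (sf ord0) (IH _ (fun i => sf (lift ord0 i)))).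
by apply: nbhT => q /=; rewrite big_ord_recl.
Qed.

Section Der.
Variable p : T.
Implicit Types X Y : tangent p.

Let der_spec X : is_derivation p X.
Proof. by have /asboolP := derP X. Qed.

Lemma der_out X f : ~ smooth T p f -> X f = 0.
Proof. by have [] := der_spec X => + _ _ _; apply. Qed.

Lemma der_local X f g : smooth T p f ->
  nbh T p [set q | f q = g q] -> X f = X g.
Proof.
by move=> sf fg; have [_ + _ _] := der_spec X; apply => //; exact: eq_smooth fg sf.
Qed.

Lemma der_lin X (a : R) f g : smooth T p f -> smooth T p g ->
  X (a *: f + g) = a * X f + X g.
Proof. by have [_ _ + _] := der_spec X; exact. Qed.

Lemma derM X f g : smooth T p f -> smooth T p g ->
  X (f * g) = X f * g p + f p * X g.
Proof. by have [_ _ _] := der_spec X; exact. Qed.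

Lemma derD X f g : smooth T p f -> smooth T p g -> X (f + g) = X f + X g.
Proof. by move=> sf sg; have := der_lin X 1 sf sg; rewrite scale1r mul1r. Qed.

Lemma der_cst X c : X (fun=> c) = 0.
Proof.
have X1 : X (fun=> 1) = 0.
  have := derM X (smooth_cst p 1) (smooth_cst p 1).
  rewrite (_ : (_ * _ : T -> R) = fun=> 1); last first.
    by apply/funext => q; rewrite fctE mulr1.
  by move/eqP; rewrite mulr1 mul1r -subr_eq0 opprD addrA subrr add0r oppr_eq0 => /eqP.
have X0 : X (fun=> 0) = 0.
  have := derD X (smooth_cst p 0) (smooth_cst p 0).
  rewrite (_ : (_ + _ : T -> R) = fun=> 0); last first.
    by apply/funext => q; rewrite fctE addr0.
  by move/eqP; rewrite -subr_eq0 opprD addrA subrr add0r oppr_eq0 => /eqP.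
have := der_lin X c (smooth_cst p 1) (smooth_cst p 0).
rewrite X1 X0 mulr0 [RHS]addr0 => <-; congr (X _).
by apply/funext => q; exact/esym/(etrans (addr0 _))/mulr1.
Qed.

Lemma derZ X (a : R) f : smooth T p f -> X (a *: f) = a * X f.
Proof.
move=> sf; have := der_lin X a sf (smooth_cst p 0).
rewrite der_cst [RHS]addr0 => <-; congr (X _).
by apply/funext => q; exact/esym/addr0.
Qed.

Lemma derN X f : smooth T p f -> X (- f) = - X f.
Proof. by move=> sf; rewrite -scaleN1r derZ// mulN1r. Qed.

Lemma derB X f g : smooth T p f -> smooth T p g -> X (f - g) = X f - X g.
Proof. by move=> sf sg; rewrite derD ?derN//; exact: smoothN. Qed.

Lemma der_sum X n (f : 'I_n -> T -> R) : (forall i, smooth T p (f i)) ->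
  X (fun q => \sum_i f i q) = \sum_i X (f i).
Proof.
elim: n f => [|n IH] f sf.
  rewrite big_ord0 -[RHS](der_cst X 0); congr (X _).
  by apply/funext => q; rewrite big_ord0.
rewrite big_ord_recl -IH// -derD//; last exact: smooth_sum.
by congr (X _); apply/funext => q; rewrite big_ord_recl.
Qed.

(** In each summand of Hadamard's expansion the first factor vanishes at [p], so the Leibniz rule
    leaves only its derivative times the value of the quotient, which is a partial derivative of
    [F]. *)
Lemma der_comp X N (g : 'I_N -> T -> R) F f :
  (forall i, smooth T p (g i)) -> smooth_near (\row_i g i p) F ->
  nbh T p [set q | f q = F (\row_i g i q)] ->
  X f = \sum_i X (g i) * partial i F (\row_i g i p).
Proof.
move=> sg sF fE; set a := \row_i g i p.
have [G [sG Ga FE]] := hadamard sF.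
pose h i q := (g i q - a 0 i) * G i (\row_j g j q).
have sga i : smooth T p (g i - (fun=> a 0 i)).
  by apply: smoothD => //; apply: smoothN; exact: smooth_cst.
have sGg i : smooth T p (fun q => G i (\row_j g j q)).
  by apply: (smooth_comp rT sg (sG i)); exact: nbhT.
have sh i : smooth T p (h i) by exact: (smoothM (sga i) (sGg i)).
have -> : X f = X ((fun=> F a) + (fun q => \sum_i h i q)).
  apply: der_local; first exact: smooth_comp fE.
  apply: nbhS (nbhI fE (smooth_row sg FE)) => q /= [-> ->]; rewrite fctE.
  by congr (_ + _); apply: eq_bigr => i _; rewrite /h mxE.
rewrite derD; [|exact: smooth_cst|exact: smooth_sum].
rewrite der_cst add0r der_sum//; apply: eq_bigr => i _.
rewrite [h i](_ : _ = (g i - (fun=> a 0 i)) * (fun q => G i (\row_j g j q)))//.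
rewrite derM// !fctE mxE subrr mul0r addr0 derB//; last exact: smooth_cst.
by rewrite der_cst subr0 Ga.
Qed.

Lemma tangent_ext X Y : (forall f, smooth T p f -> X f = Y f) -> X = Y.
Proof.
move=> XY; apply: val_inj; apply/funext => f /=.
by have [/XY//|sf] := pselect (smooth T p f); rewrite !der_out.
Qed.

Lemma tangentD X Y f : (X + Y) f = X f + Y f.
Proof. by []. Qed.

Lemma tangentZ (a : R) X f : (a *: X) f = a * X f.
Proof. by []. Qed.

Lemma tangentN X f : (- X) f = - X f.
Proof. by []. Qed.

Lemma tangent0 f : (0 : tangent p) f = 0.
Proof. by []. Qed.

Lemma tangent_sum n (X : 'I_n -> tangent p) f : (\sum_i X i) f = \sum_i X i f.
Proof.
elim: n X => [|n IH] X; first by rewrite !big_ord0.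
by rewrite !big_ord_recl tangentD IH.
Qed.

(** The premises are locality, linearity and the Leibniz rule on smooth germs; they exclude the
    fallback of [mk_tangent] to the zero vector. *)
Lemma mk_tangentE (D : (T -> R) -> R) f :
  (forall f g, smooth T p f -> smooth T p g ->
     nbh T p [set q | f q = g q] -> D f = D g) ->
  (forall (a : R) f g, smooth T p f -> smooth T p g ->
     D (a *: f + g) = a * D f + D g) ->
  (forall f g, smooth T p f -> smooth T p g ->
     D (f * g) = D f * g p + f p * D g) ->
  smooth T p f -> mk_tangent p D f = D f.
Proof.
move=> Dl DD DM sf.
have D' : is_derivation p
    (fun f => if `[< smooth T p f >] then D f else 0).
  split.
  - by move=> g ng; rewrite asboolF.
  - by move=> g h sg sh gh; rewrite !asboolT//; exact: Dl.
  - move=> a g h sg sh; rewrite !asboolT ?DD//.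
    by apply: smoothD => //; exact: smoothZ.
  - by move=> g h sg sh; rewrite !asboolT ?DM//; exact: smoothM.
rewrite /mk_tangent /insubd insubT /=; first exact/asboolP.
by move=> _; rewrite asboolT.
Qed.

Lemma velocityE (c : R -> T) f : c 0 = p ->
  (forall A, nbh T p A -> \forall t \near (0 : R), A (c t)) ->
  (forall f, smooth T p f -> derivable (f \o c) 0 1) ->
  smooth T p f -> velocity p c f = derive1 (f \o c) 0.
Proof.
move=> c0 cc dc; apply: mk_tangentE.
- move=> {}f g _ _ /cc fg; rewrite !derive1E; exact: near_eq_derive.
- move=> a {}f g sf sg; rewrite !derive1E.
  transitivity ('D_1 (a *: (f \o c) + (g \o c)) (0 : R)) => //.
  have [df dg] := (dc f sf, dc g sg).
  by rewrite deriveD//; [rewrite deriveZ|exact: derivableZ].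
- move=> {}f g sf sg; rewrite !derive1E.
  transitivity ('D_1 ((f \o c) * (g \o c)) (0 : R)) => //.
  rewrite deriveM; [|exact: dc|exact: dc].
  by rewrite addrC /= c0 /GRing.scale/= mulrC.
Qed.

End Der.

(** * Smooth vector fields and brackets *)

Section VectorFields.
Variable p : T.
Implicit Types X Y Z : vfield T.

Lemma eq_smooth_vfield X Y : nbh T p [set q | X q = Y q] ->
  smooth_vfield p X -> smooth_vfield p Y.
Proof.
by move=> XY sX f /sX; apply: eq_smooth; apply: nbhS XY => q /= ->.
Qed.

Lemma smooth_vfieldZ f X : smooth T p f -> smooth_vfield p X ->
  smooth_vfield p (fun q => f q *: X q).
Proof. by move=> sf sX g sg; exact: smoothM sf (sX g sg). Qed.

Lemma smooth_vfield_sum n (X : 'I_n -> vfield T) :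
  (forall i, smooth_vfield p (X i)) -> smooth_vfield p (fun q => \sum_i X i q).
Proof.
move=> sX f sf; apply: eq_smooth (smooth_sum (fun i => sX i f sf)).
by apply: nbhT => q /=; rewrite tangent_sum.
Qed.

(** The iterated derivative of a product has the extra terms X f * Y g + Y f * X g. They are
    symmetric in [X] and [Y] and cancel in the commutator, which is thus a derivation. *)
Lemma bracketE X Y f : smooth_vfield p X -> smooth_vfield p Y ->
  smooth T p f ->
  bracket X Y p f = X p (fun q => Y q f) - Y p (fun q => X q f).
Proof.
move=> sX sY; apply: mk_tangentE.
- move=> {}f g sf sg fg.
  have E Z : nbh T p [set q | Z q f = Z q g].
    apply: nbhS (nbhI (nbh_nbh rT fg) (smooth_nbh rT sf)) => q /= [qfg qf].
    exact: der_local.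
  by congr (_ - _); apply: der_local; rewrite ?E//; [exact: sY|exact: sX].
- move=> a {}f g sf sg.
  have E Z (W : vfield T) : smooth_vfield p Z ->
      W p (fun q => Z q (a *: f + g)) = a * W p (fun q => Z q f) + W p (fun q => Z q g).
    move=> sZ; rewrite -[RHS](der_lin _ a (sZ f sf) (sZ g sg)).
    apply/esym/der_local; first exact: smoothD (smoothZ a (sZ f sf)) (sZ g sg).
    apply: nbhS (nbhI (smooth_nbh rT sf) (smooth_nbh rT sg)) => q /= [qf qg].
    by rewrite der_lin.
  rewrite !E//; ring.
- move=> {}f g sf sg.
  have E Z (W : vfield T) : smooth_vfield p Z ->
      W p (fun q => Z q (f * g)) = W p (fun q => Z q f) * g p + Z p f * W p g
        + (W p f * Z p g + f p * W p (fun q => Z q g)).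
    move=> sZ.
    have sfg := smoothM (sZ f sf) sg; have sgf := smoothM sf (sZ g sg).
    rewrite -[X in X + _](derM _ (sZ f sf) sg) -[X in _ + X](derM _ sf (sZ g sg)).
    rewrite -[RHS](derD _ sfg sgf).
    apply/esym/der_local; first exact: smoothD.
    apply: nbhS (nbhI (smooth_nbh rT sf) (smooth_nbh rT sg)) => q /= [qf qg].
    by rewrite derM.
  rewrite !E//; ring.
Qed.

End VectorFields.

End Regular.

(** * Differentials of smooth maps *)

Section SmoothMaps.
Context {R : realType} {T T' : germSpace R}.
Hypotheses (rT : regular T) (rT' : regular T').

Definition smooth_map (phi : T -> T') (u : T) : Prop :=
  (forall f, smooth T' (phi u) f -> smooth T u (f \o phi)) /\
  (forall A, nbh T' (phi u) A -> nbh T u (phi @^-1` A)).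

Lemma dmapE (phi : T -> T') u (X : tangent u) f : smooth_map phi u ->
  smooth T' (phi u) f -> dmap phi X f = X (f \o phi).
Proof.
move=> [sphi nphi]; apply: mk_tangentE => //.
- move=> {}f g sf sg fg; apply: (der_local rT); first exact: sphi.
  exact: nphi fg.
- by move=> a {}f g sf sg; exact: (der_lin _ a (sphi f sf) (sphi g sg)).
- by move=> {}f g sf sg; exact: (derM _ (sphi f sf) (sphi g sg)).
Qed.

Lemma dmap_linear (phi : T -> T') u (a : R) (X Y : tangent u) :
  smooth_map phi u -> dmap phi (a *: X + Y) = a *: dmap phi X + dmap phi Y.
Proof.
move=> sphi; apply: tangent_ext => f sf.
by rewrite tangentD tangentZ !dmapE// tangentD tangentZ.
Qed.

End SmoothMaps.

Lemma smooth_map_comp (R : realType) (T T' T'' : germSpace R)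
    (phi : T -> T') (psi : T' -> T'') u :
  smooth_map phi u -> smooth_map psi (phi u) -> smooth_map (psi \o phi) u.
Proof.
move=> [sphi nphi] [spsi npsi]; split=> [f /spsi/sphi//|A /npsi/nphi//].
Qed.

Lemma dmap_comp (R : realType) (T T' T'' : germSpace R)
    (rT : regular T) (rT' : regular T') (rT'' : regular T'')
    (phi : T -> T') (psi : T' -> T'') u (X : tangent u) :
  smooth_map phi u -> smooth_map psi (phi u) ->
  dmap (psi \o phi) X = dmap psi (dmap phi X).
Proof.
move=> sphi spsi; apply: tangent_ext => f sf.
rewrite !dmapE//; first exact: spsi.1.
exact: smooth_map_comp.
Qed.

(** * Manifolds in charts *)

Section Manifold.
Context {R : realType} {m : nat} {M : manifold R m}.
Implicit Types (c : chart M) (p q : M) (f : M -> R).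

Lemma cdom_nbhs c p : cdom c p -> nbhs p (cdom c).
Proof. by move=> cp; apply: open_nbhs_nbhs; split=> //; exact: cdom_open. Qed.

Lemma near_cmap c p (B : set 'rV[R]_m) : cdom c p -> nbhs (cmap c p) B ->
  nbh M p [set q | B (cmap c q)].
Proof.
move=> cp; have := @cmap_cont _ _ M c.
rewrite (continuous_open_subspace _ (@cdom_open _ _ M c)) => /(_ p (mem_set cp)).
exact.
Qed.

Lemma near_cinv c p (A : set M) : cdom c p -> nbh M p A ->
  \forall y \near cmap c p, A (cinv c y).
Proof.
move=> cp pA; have := @cinv_cont _ _ M c.
rewrite (continuous_open_subspace _ (@cmap_open _ _ M c)) => /(_ (cmap c p)).
by apply; [apply/mem_set; exists p|rewrite cmapK].
Qed.

Lemma near_cdom c p : cdom c p ->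
  \forall y \near cmap c p, cdom c (cinv c y) /\ cmap c (cinv c y) = y.
Proof.
move=> cp; have : nbhs (cmap c p) (cmap c @` cdom c).
  by apply: open_nbhs_nbhs; split; [exact: cmap_open|exists p].
by apply: filterS => _ [q cq <-]; rewrite cmapK.
Qed.

Lemma row_coord (x : 'rV[R]_m) : \row_i x 0 i = x.
Proof. by apply/rowP => i; rewrite mxE. Qed.

(** Chart changes are smooth, so the chart whose existence defines smoothness can be traded for any
    chart around [p]. *)
Lemma smooth_chart c p f : cdom c p ->
  smooth M p f <-> smooth_near (cmap c p) (f \o cinv c).
Proof.
move=> cp; split=> [[c' [c'p sf]]|sf]; last by exists c.
have sc i : smooth_near (cmap c p) (fun y => cmap c' (cinv c y) 0 i).
  exact: chart_compat.
have : smooth_near (cmap c p)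
    (fun y => (f \o cinv c') (\row_i cmap c' (cinv c y) 0 i)).
  by apply: smooth_near_comp => //; rewrite row_coord cmapK.
apply: eq_smooth_near.
have := near_cinv cp (cdom_nbhs c'p); apply: filterS => y c'y /=.
by rewrite row_coord cmapK.
Qed.

Definition chart_coord c (i : 'I_m) p : R := cmap c p 0 i.

Lemma row_coordE c p : \row_i chart_coord c i p = cmap c p.
Proof. exact: row_coord. Qed.

Lemma smooth_coord c p i : cdom c p -> smooth M p (chart_coord c i).
Proof.
move=> cp; apply/(smooth_chart _ cp).
apply: eq_smooth_near (smooth_near_coord _ i).
have := near_cdom cp; apply: filterS => y [_ yE].
by rewrite /= /chart_coord yE.
Qed.

Lemma manifold_regular : regular M.
Proof.
have N p : Filter (nbh M p) by exact: nbhs_filter.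
split=> //.
- by move=> p A; exact: nbhs_singleton.
- by move=> p A pA; exact: nbhs_interior.
- move=> p f [c [cp sf]].
  apply: filterS2 (cdom_nbhs cp) (near_cmap cp (smooth_near_near sf)) => q cq sq.
  by exists c.
- move=> p n g F f sg sF fE; have [c cp] := chart_cover p.
  apply/(smooth_chart _ cp).
  have : smooth_near (cmap c p) (fun y => F (\row_i (g i \o cinv c) y)).
    apply: smooth_near_comp => [j|]; first exact/(smooth_chart _ cp).
    by rewrite (_ : \row_j _ = \row_j g j p)//; apply/rowP => j; rewrite !mxE/= cmapK.
  apply: eq_smooth_near; have := near_cinv cp fE; apply: filterS => y /= ->.
  by [].
- move=> p f e [c [cp sf]] e0.
  have cf : {for cmap c p, continuous (f \o cinv c)}.
    by apply: differentiable_continuous; exact: smooth_near_diff.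
  have cfe : nbh M p
      [set q | `|f (cinv c (cmap c p)) - f (cinv c (cmap c q))| < e].
    exact: near_cmap cp ((cvgrPdist_lt _ _).1 cf e e0).
  apply: filterS2 (cdom_nbhs cp) cfe => q cq /=.
  by rewrite !cmapK// distrC.
Qed.

Let rM := manifold_regular.

Lemma der_chart c p (X : tangent p) f : cdom c p -> smooth M p f ->
  X f = \sum_i X (chart_coord c i) * partial i (f \o cinv c) (cmap c p).
Proof.
move=> cp sf; rewrite -[cmap c p](row_coordE c p).
apply: (der_comp rM) => [i||].
- exact: smooth_coord.
- by rewrite row_coordE; exact/(smooth_chart _ cp).
- apply: filterS (cdom_nbhs cp) => q cq /=.
  by rewrite row_coordE cmapK.
Qed.

(** The coordinate field of the chart, made total; its formula is meaningful only over [cdom c]. *)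
Definition cfield c i : vfield M := fun p =>
  mk_tangent p (fun f => partial i (f \o cinv c) (cmap c p)).

Lemma cfieldE c i p f : cdom c p -> smooth M p f ->
  cfield c i p f = partial i (f \o cinv c) (cmap c p).
Proof.
move=> cp; apply: (mk_tangentE rM).
- move=> {}f g _ _ fg; apply: near_eq_derive; exact: near_cinv cp fg.
- move=> a {}f g /(smooth_chart _ cp)/smooth_near_diff df
    /(smooth_chart _ cp)/smooth_near_diff dg.
  have {}df : derivable (f \o cinv c) (cmap c p) 'e_i by exact: diff_derivable.
  have {}dg : derivable (g \o cinv c) (cmap c p) 'e_i by exact: diff_derivable.
  transitivity ('D_('e_i) (a *: (f \o cinv c) + (g \o cinv c)) (cmap c p)) => //.
  by rewrite deriveD//; [rewrite deriveZ|exact: derivableZ].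
- move=> {}f g /(smooth_chart _ cp)/smooth_near_diff df
    /(smooth_chart _ cp)/smooth_near_diff dg.
  have {}df : derivable (f \o cinv c) (cmap c p) 'e_i by exact: diff_derivable.
  have {}dg : derivable (g \o cinv c) (cmap c p) 'e_i by exact: diff_derivable.
  transitivity ('D_('e_i) ((f \o cinv c) * (g \o cinv c)) (cmap c p)) => //.
  by rewrite deriveM// addrC /= cmapK// /GRing.scale/= mulrC.
Qed.

Lemma smooth_cfield c i p : cdom c p -> smooth_vfield p (cfield c i).
Proof.
move=> cp f sf; apply/(smooth_chart _ cp).
apply: eq_smooth_near (smooth_near_partial i ((smooth_chart _ cp).1 sf)).
have sf' := near_cinv cp (smooth_nbh rM sf).
apply: filterS2 (near_cdom cp) sf' => y [cy yE] sy /=.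
by rewrite cfieldE// yE.
Qed.

Lemma cfield_coord c i j p : cdom c p -> cfield c i p (chart_coord c j) = (i == j)%:R.
Proof.
move=> cp; rewrite cfieldE//; last exact: smooth_coord.
rewrite -(partial_coord i j (cmap c p)); apply: near_eq_derive.
have := near_cdom cp; apply: filterS => y [_ yE].
by rewrite /= /chart_coord yE.
Qed.

Lemma tangent_chart c p (X : tangent p) : cdom c p ->
  X = \sum_i X (chart_coord c i) *: cfield c i p.
Proof.
move=> cp; apply: tangent_ext => f sf.
rewrite (der_chart _ cp)// tangent_sum; apply: eq_bigr => i _.
by rewrite tangentZ cfieldE.
Qed.

Lemma eq_tangent_chart c p (X Y : tangent p) : cdom c p ->
  (forall i, X (chart_coord c i) = Y (chart_coord c i)) -> X = Y.
Proof.
move=> cp XY; rewrite (tangent_chart X cp) (tangent_chart Y cp).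
by apply: eq_bigr => i _; rewrite XY.
Qed.

(** No symmetry of second derivatives is needed: a tangent vector is determined by its values on the
    coordinates, and there both terms of the bracket differentiate a locally constant function. *)
Lemma bracket_cfield c i j p : cdom c p ->
  bracket (cfield c i) (cfield c j) p = 0.
Proof.
move=> cp; apply: (eq_tangent_chart cp) => k.
rewrite (bracketE rM); [|exact: smooth_cfield|exact: smooth_cfield|exact: smooth_coord].
have E l l' : cfield c l p (fun q => cfield c l' q (chart_coord c k)) = 0.
  rewrite -(der_cst rM (cfield c l p) (l' == k)%:R); apply: (der_local rM).
    by apply: smooth_cfield => //; exact: smooth_coord.
  by apply: filterS (cdom_nbhs cp) => q cq /=; exact: cfield_coord.
by rewrite !E subrr tangent0.
Qed.

(** Smoothness at [p] is tested on all germs at [p], so it is not visibly an open condition. The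
    finitely many coordinate components decide it, and each of them is smooth near [p]. *)
Lemma smooth_vfield_nbh p (X : vfield M) : smooth_vfield p X ->
  nbh M p [set q | smooth_vfield q X].
Proof.
move=> sX; have [c cp] := chart_cover p.
have sXc : nbh M p [set q | forall i, smooth M q (fun q' => X q' (chart_coord c i))].
  apply: (nbh_forall rM) => i; apply: (smooth_nbh rM); apply: sX.
  exact: smooth_coord.
apply: filterS2 sXc (cdom_nbhs cp) => q sq cq.
have : smooth_vfield q (fun q' => \sum_i X q' (chart_coord c i) *: cfield c i q').
  apply: (smooth_vfield_sum rM) => i; apply: (smooth_vfieldZ rM) => //.
  exact: smooth_cfield.
apply: (eq_smooth_vfield rM).
by apply: filterS (cdom_nbhs cq) => q' cq'; rewrite /= -tangent_chart.
Qed.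

End Manifold.

(** * Generated germ spaces *)

Section GeneratedOver.
Context {R : realType} {B : germSpace R} (S : Type) (pr : S -> B).
Variable gens : S -> set (S -> R).
Hypothesis rB : regular B.
(** Generators are attached to points. This makes them persist over a neighbourhood in the base, so
    that neighbourhoods and smoothness propagate to nearby points. *)
Hypothesis gens_nbh : forall u g, gens u g ->
  nbh B (pr u) [set b | forall v, pr v = b -> gens v g].

Let T := generated
  (fun u => [set V | exists2 U, nbh B (pr u) U & V = pr @^-1` U]) gens.

Lemma nbh_pr (u : T) U : nbh B (pr u) U -> nbh T u (pr @^-1` U).
Proof.
move=> uU; exists 0%N, (fun _ _ => 0), 1, (pr @^-1` U); split=> //.
  by case.
by exists U.
Qed.

Lemma nbh_gens (u : T) g e : gens u g -> 0 < e ->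
  nbh T u [set v | `|g v - g u| < e].
Proof.
move=> ug e0; have FF := nbh_filter rB (pr u).
exists 1%N, (fun=> g), e, setT; split=> //.
  by exists setT => //; exact: filterT.
by move=> v _ /(_ ord0).
Qed.

Let nbh_filterT (u : T) : Filter (nbh T u).
Proof.
split.
- exact: nbh_pr (@filterT _ _ (nbh_filter rB (pr u))).
- move=> A A' [N [g [e [_ [gu e0 [U uU ->] gA]]]]].
  move=> [N' [g' [e' [_ [gu' e0' [U' uU' ->] gA']]]]].
  exists (N + N')%N, (fun i => match fintype.split i with
                       inl j => g j | inr j => g' j end), (Num.min e e'),
    (pr @^-1` (U `&` U')); split.
  + by move=> i; case: split_ordP => j _.
  + by rewrite lt_min e0.
  + by exists (U `&` U') => //; exact: (nbhI rB).
  + move=> v [Uv U'v] ve; split.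
    * apply: gA => // i; have := ve (lshift N' i).
      by case: split_ordP => j /eqP; rewrite ?eq_lshift ?eq_lrshift// => /eqP <-;
        rewrite lt_min => /andP[].
    * apply: gA' => // i; have := ve (rshift N i).
      by case: split_ordP => j /eqP; rewrite ?eq_rshift ?eq_rlshift// => /eqP <-;
        rewrite lt_min => /andP[].
- move=> A A' AA' [N [g [e [V [gu e0 uV gA]]]]]; exists N, g, e, V; split=> //.
  by move=> v Vv /(gA v Vv)/AA'.
Qed.

Let gS (u : T) (A A' : set T) : A `<=` A' -> nbh T u A -> nbh T u A'.
Proof. by have := nbh_filterT u => ?; exact: filterS. Qed.

Let gI (u : T) (A A' : set T) : nbh T u A -> nbh T u A' -> nbh T u (A `&` A').
Proof. by have := nbh_filterT u => ?; exact: filterI. Qed.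

Lemma smooth_gens (u : T) g : gens u g -> smooth T u g.
Proof.
move=> ug; exists 1%N, (fun=> g), (fun x => x 0 ord0); split=> //.
  exact: smooth_near_coord.
apply: gS (@filterT _ _ (nbh_filterT u)) => v _ /=; by rewrite mxE.
Qed.

Let nbh_forallT (u : T) (I : finType) (A : I -> set T) :
  (forall i, nbh T u (A i)) -> nbh T u [set v | forall i, A i v].
Proof. by move=> uA; exact: (filter_forall (nbh_filterT u)). Qed.

Let nbh_gens_near (u : T) g : gens u g -> nbh T u [set v | gens v g].
Proof.
by move=> /gens_nbh/nbh_pr; apply: gS => v; exact.
Qed.

Let nbh_nbhT (u : T) A : nbh T u A -> nbh T u [set v | nbh T v A].
Proof.
move=> [N [g [e [_ [gu e0 [U uU ->] gA]]]]].
have H1 := nbh_pr (nbh_nbh rB uU).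
have H2 := nbh_forallT (fun i => nbh_gens (gu i) e0).
have H3 := nbh_forallT (fun i => nbh_gens_near (gu i)).
apply: gS (gI H1 (gI H2 H3)) => v [/= /nbh_pr vU [ve vg]].
have ve' i : 0 < e - `|g i v - g i u| by rewrite subr_gt0 ve.
have H4 := nbh_forallT (fun i => nbh_gens (vg i) (ve' i)).
apply: gS (gI vU H4) => w [Uw wv].
apply: gA => // i; have /= := wv i; rewrite ltrBrDr; apply: le_lt_trans.
by rewrite -(subrKA (g i v)) ler_normD.
Qed.

Let gens_row (u : T) N (g : 'I_N -> T -> R) (A : set 'rV[R]_N) :
  (forall i, gens u (g i)) -> nbhs (\row_i g i u) A ->
  nbh T u [set v | A (\row_i g i v)].
Proof.
move=> ug /nbhs_ballP[e /= e0 eA].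
apply: gS (nbh_forallT (fun i => nbh_gens (ug i) e0)) => v /= ve.
by apply: eA; split=> // i j; rewrite !mxE /ball/= distrC; exact: ve.
Qed.

Lemma generated_regular : regular T.
Proof.
have FT := nbh_filterT; split=> //.
- move=> u A [N [g [e [_ [gu e0 [U uU ->] gA]]]]]; apply: gA.
    exact: nbh_self uU.
  by move=> i; rewrite subrr normr0.
- move=> u f [N [g [F [gu sF fE]]]].
  have H1 := gens_row gu (smooth_near_near sF).
  have H2 := nbh_forallT (fun i => nbh_gens_near (gu i)).
  have := gI H1 (gI H2 (nbh_nbhT fE)).
  by apply: filterS => v [sFv [gv fEv]]; exists N, g, F.
- move=> u n h F f sh sF fE.
  have H i : {N : nat & {g : 'I_N -> T -> R & {G : 'rV[R]_N -> R |
      [/\ forall j, gens u (g j), smooth_near (\row_j g j u) G &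
          nbh T u [set v | h i v = G (\row_j g j v)]]}}}.
    by have /cid[N /cid[g /cid[G HG]]] := sh i; exists N, g, G.
  pose N i := tag (H i); pose g i := tag (tagged (H i)).
  pose G i := sval (tagged (tagged (H i))).
  have HG i : [/\ forall j, gens u (g i j), smooth_near (\row_j g i j u) (G i) &
      nbh T u [set v | h i v = G i (\row_j g i j v)]].
    exact: svalP (tagged (tagged (H i))).
  (* Each [h i] is a function of its own finite family of generators. The families are merged into
     one, indexed by their disjoint union, and [pick i] extracts the arguments of [G i]. *)
  pose I : finType := {i : 'I_n & 'I_(N i)}.
  pose g' (k : 'I_#|I|) := g (tag (enum_val k)) (tagged (enum_val k)).
  pose pick i (x : 'rV[R]_#|I|) : 'rV[R]_(N i) :=
    \row_j x 0 (enum_rank (Tagged (fun i => 'I_(N i)) j)).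
  have pickE i v : pick i (\row_k g' k v) = \row_j g i j v.
    by apply/rowP => j; rewrite !mxE /g' enum_rankK.
  exists #|I|, g', (fun x => F (\row_i G i (pick i x))); split.
  + by move=> k; have [+ _ _] := HG (tag (enum_val k)); exact.
  + apply: smooth_near_comp => [i|].
      apply: smooth_near_comp => [j|]; first exact: smooth_near_coord.
      by rewrite -/(pick i _) pickE; have [_ + _] := HG i; exact.
    rewrite (_ : \row_i _ = \row_i h i u)//; apply/rowP => i.
    rewrite !mxE pickE; have [_ _] := HG i.
    move=> [? [? [? [_ [gu' e0' [U uU ->] gA']]]]]; symmetry; apply: gA'.
      exact: nbh_self uU.
    by move=> j; rewrite subrr normr0.
  + have hG i : nbh T u [set v | h i v = G i (\row_j g i j v)] by have [] := HG i.
    apply: gS (gI fE (nbh_forallT hG)) => v [/= -> hGv]; congr F.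
    by apply/rowP => i; rewrite !mxE pickE hGv.
- move=> u f e [N [g [F [gu sF fE]]]] e0.
  have cF := differentiable_continuous (smooth_near_diff sF).
  have H1 : nbh T u [set v | `|F (\row_i g i u) - F (\row_i g i v)| < e].
    exact: gens_row gu ((cvgrPdist_lt _ _).1 cF e e0).
  have fu : f u = F (\row_i g i u).
    move: fE => [? [? [? [_ [gu' e0' [U uU ->] gA']]]]]; apply: gA'.
      exact: nbh_self uU.
    by move=> j; rewrite subrr normr0.
  apply: gS (gI fE H1) => v [/= -> Hv].
  by rewrite fu distrC.
Qed.

Let rT := generated_regular.

(** A smooth germ is a smooth function of finitely many generators, so the chain rule determines a
    derivation from its values on them. *)
Lemma eq_tangent_gens (u : T) (X Y : tangent u) :
  (forall g, gens u g -> X g = Y g) -> X = Y.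
Proof.
move=> XY; apply: tangent_ext => f [N [g [F [gu sF fE]]]].
have sg i := smooth_gens (gu i).
rewrite !(der_comp rT _ sg sF fE).
by apply: eq_bigr => i _; rewrite XY.
Qed.

Lemma smooth_map_generated (T0 : germSpace R) (phi : T0 -> T) x :
  regular T0 ->
  (forall U, nbh B (pr (phi x)) U -> nbh T0 x (phi @^-1` (pr @^-1` U))) ->
  (forall g, gens (phi x) g -> smooth T0 x (g \o phi)) ->
  smooth_map phi x.
Proof.
move=> r0 nphi sphi.
have nphi' A : nbh T (phi x) A -> nbh T0 x (phi @^-1` A).
  move=> [N [g [e [_ [gu e0 [U uU ->] gA]]]]].
  have H := nbh_forall r0 (fun i => smooth_cont r0 (sphi _ (gu i)) e0).
  by apply: (nbhS r0 _ (nbhI r0 (nphi U uU) H)) => y [Uy gy]; exact: gA.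
split=> // f [N [g [F [gu sF fE]]]].
apply: (smooth_comp r0 (g := fun i => g i \o phi) (F := F)) => //.
  by move=> i; exact: sphi.
exact: nphi' fE.
Qed.

(** Derivability of the generators along [c] makes them continuous at 0, so [c] enters every
    neighbourhood of the initial topology; the chain rule on R^N then covers all smooth germs. *)
Lemma generated_curve (c : R -> T) u : c 0 = u ->
  (forall U, nbh B (pr u) U -> \forall t \near (0 : R), U (pr (c t))) ->
  (forall g, gens u g -> derivable (g \o c) 0 1) ->
  (forall A, nbh T u A -> \forall t \near (0 : R), A (c t)) /\
  (forall f, smooth T u f -> derivable (f \o c) 0 1).
Proof.
move=> c0 cpr dc.
have N0 A : nbh T u A -> \forall t \near (0 : R), A (c t).
  move=> [N [g [e [_ [gu e0 [U uU ->] gA]]]]].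
  have H i : \forall t \near (0 : R), `|g i (c t) - g i u| < e.
    have /derivable1_diffP/differentiable_continuous cg := dc _ (gu i).
    have : \forall t \near (0 : R), `|g i (c 0) - g i (c t)| < e.
      exact: (cvgrPdist_lt _ _).1 cg e e0.
    by apply: filterS => t /=; rewrite c0 distrC.
  have {}H : \forall t \near (0 : R), forall i, `|g i (c t) - g i u| < e.
    exact: (filter_forall (nbhs_filter (0 : R)) H).
  by apply: filterS2 H (cpr U uU) => t Ht Ut; exact: gA.
split=> // f [N [g [F [gu sF fE]]]].
apply: (near_eq_derivable (f := fun t => F (\row_i g i (c t)))).
  by apply: filterS (N0 _ fE) => t /= ->.
apply: diff_derivable.
apply: (differentiable_comp (f := fun t => \row_i g i (c t)) (g := F)).
  apply: (differentiable_row _).1 => i; apply/derivable1_diffP; exact: dc.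
by rewrite c0; exact: smooth_near_diff.
Qed.

End GeneratedOver.

(** * The frame bundle and the Swann bundle *)

(** The derivative is the matrix of ad e_a: column [a + 1] is 2 e_(a+2) and column [a + 2] is -2
    e_(a+1). The factor 2 comes from the angle [2 * t]. *)
Lemma is_derive_rot (R : realType) (a i j : 'I_3) :
  is_derive (0 : R) 1 (fun t => rot_mx a t i j)
    (if j == a then 0 else if j == a + 1 then 2 * (i == a + 2)%:R
     else - (2 * (i == a + 1)%:R)).
Proof.
have d2 : is_derive (0 : R) 1 (fun t : R => 2 * t) 2.
  by apply: is_derive_eq; rewrite /GRing.scale/= mulr1.
have dcos : is_derive (0 : R) 1 (fun t : R => cos (2 * t)) 0.
  apply: (is_derive_eq (is_derive1_comp (is_derive_cos (2 * 0)) d2)).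
  by rewrite mulr0 sin0 oppr0 /GRing.scale/= mul0r.
have dsin : is_derive (0 : R) 1 (fun t : R => sin (2 * t)) 2.
  apply: (is_derive_eq (is_derive1_comp (is_derive_sin (2 * 0)) d2)).
  by rewrite mulr0 cos0 /GRing.scale/= mul1r.
case: ifPn => ja.
  rewrite (_ : (fun _ => _) = fun=> (i == a)%:R).
    exact: is_derive_cst.
  by apply/funext => t; rewrite mxE ja.
case: ifPn => ja1.
- rewrite (_ : (fun _ => _) =
    (i == a + 1)%:R *: (fun t => cos (2 * t)) +
    (i == a + 2)%:R *: (fun t => sin (2 * t))).
    apply: is_derive_eq (is_deriveD (is_deriveZ _ dcos) (is_deriveZ _ dsin)) _.
    by rewrite /GRing.scale/= mulr0 add0r mulrC.
  by apply/funext => t; rewrite mxE (negbTE ja) ja1 !fctE mulrC [X in _ + X]mulrC.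
- rewrite (_ : (fun _ => _) =
    - (i == a + 1)%:R *: (fun t => sin (2 * t)) +
    (i == a + 2)%:R *: (fun t => cos (2 * t))).
    apply: is_derive_eq (is_deriveD (is_deriveZ _ dsin) (is_deriveZ _ dcos)) _.
    by rewrite /GRing.scale/= mulr0 addr0 mulNr mulrC.
  apply/funext => t; rewrite mxE (negbTE ja) (negbTE ja1) !fctE.
  by rewrite mulNr mulrC [X in _ + X]mulrC -mulNr.
Qed.

Section Frames.
Context {R : realType} {m : nat} {M : manifold R m} {Q : endsubset M}.
Implicit Types (s : frame_bundle Q) (A : @SO3 R).

Lemma frame_eq (p : M) (I J : frame Q p) : fr I = fr J -> I = J.
Proof.
case: I J => [I hI] [J hJ] /= E; move: hI hJ; rewrite E => hI hJ.
by congr Frame; exact: Prop_irrelevance.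
Qed.

Let rM : regular M := manifold_regular.

Definition frame_gens (s : frames Q) : set (frames Q -> R) := [set g |
  (exists2 f, smooth M (frames_proj s) f & g = f \o @frames_proj _ _ _ Q) \/
  (exists a (X : vfield M) f,
    [/\ smooth_vfield (frames_proj s) X, smooth M (frames_proj s) f &
        g = fun s' => frames_fr a (X (frames_proj s')) f])].

(** For a matrix coefficient this rests on the openness of the smoothness of a vector field. *)
Lemma frame_bundle_gens_nbh (s : frames Q) g : frame_gens s g ->
  nbh M (frames_proj s)
    [set b | forall s' : frames Q, frames_proj s' = b -> frame_gens s' g].
Proof.
move=> [[f sf ->]|[a [X [f [sX sf ->]]]]].
- apply: (nbhS rM _ (smooth_nbh rM sf)) => b sb v vb; left.
  by exists f => //; rewrite vb.
- have sfX := nbhI rM (smooth_nbh rM sf) (smooth_vfield_nbh sX).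
  apply: (nbhS rM _ sfX) => b [sb sXb] v vb.
  by right; exists a, X, f; rewrite vb.
Qed.

Lemma frame_bundle_regular : regular (frame_bundle Q).
Proof. exact: generated_regular rM frame_bundle_gens_nbh. Qed.

Let rS := frame_bundle_regular.

Definition mcoef a (X : vfield M) f : frame_bundle Q -> R :=
  fun s => frames_fr a (X (frames_proj s)) f.

Lemma smooth_mcoef s a X f : smooth_vfield (piS s) X -> smooth M (piS s) f ->
  smooth (frame_bundle Q) s (mcoef a X f).
Proof.
move=> sX sf; apply: (smooth_gens rM).
by right; exists a, X, f.
Qed.

Lemma smooth_piS s : smooth_map (@piS _ _ _ Q) s.
Proof.
split=> [f sf|A pA].
  by apply: (smooth_gens rM); left; exists f.
exact: (nbh_pr (pr := @frames_proj _ _ _ Q) pA).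
Qed.

Lemma mcoef_act A s a X f :
  mcoef a X f (actS A s) = \sum_b A b a * mcoef b X f s.
Proof. by rewrite /mcoef /frames_fr /= /rotate tangent_sum. Qed.

Lemma smooth_actS A s : smooth_map (actS A) s.
Proof.
apply: (smooth_map_generated (pr := @frames_proj _ _ _ Q) rS) => [U pU|].
  exact: (smooth_piS s).2.
move=> _ [[f sf ->]|[a [X [f [sX sf ->]]]]]; first exact: (smooth_piS s).1.
have : smooth (frame_bundle Q) s (fun s' => \sum_b A b a * mcoef b X f s').
  by apply: (smooth_sum rS) => b; apply: (smoothZ rS); exact: smooth_mcoef.
apply: (eq_smooth rS); apply: (nbhT rS) => s' /=.
by rewrite -mcoef_act.
Qed.

Lemma actS_rot0 s a : actS (Defs.rot a 0) s = s.
Proof.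
case: s => p I; rewrite /actS /=; congr existT; apply: frame_eq => /=.
apply/funext => c; apply/funext => x; rewrite /rotate (bigD1 c)//= big1 => [|b bc].
  rewrite addr0 (_ : rot_mx a 0 c c = 1) ?scale1r// mxE mulr0 cos0 sin0.
  by elim/ord3P : a; elim/ord3P: c; rewrite /= ?mulr1 ?mulr0 ?addr0 ?add0r.
rewrite (_ : rot_mx a 0 b c = 0) ?scale0r// mxE mulr0 cos0 sin0.
by move: bc; elim/ord3P : a; elim/ord3P: c; elim/ord3P : b;
  rewrite //= ?mulr1 ?mulr0 ?addr0 ?add0r ?oppr0 ?mul0r.
Qed.

(** A matrix coefficient of the rotated frame is linear in the entries of the rotation, so only
    these are differentiated. *)
Lemma is_derive_mcoef_rot s a b X f :
  is_derive (0 : R) 1 (fun t => mcoef b X f (actS (Defs.rot a t) s))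
    (\sum_d (if b == a then 0 else if b == a + 1 then 2 * (d == a + 2)%:R
     else - (2 * (d == a + 1)%:R)) * mcoef d X f s).
Proof.
rewrite (_ : (fun _ => _) = \sum_d (fun t : R => mcoef d X f s *: rot_mx a t d b)).
  apply: is_derive_eq.
    by apply: is_derive_sum => d; apply: is_deriveZ; exact: is_derive_rot.
  by apply: eq_bigr => d _; rewrite /GRing.scale/= mulrC.
apply/funext => t; rewrite mcoef_act fct_sumE.
by apply: eq_bigr => d _; rewrite /GRing.scale/= mulrC.
Qed.

Lemma rot_curve s a :
  (forall N, nbh (frame_bundle Q) s N ->
     \forall t \near (0 : R), N (actS (Defs.rot a t) s)) /\
  (forall f, smooth (frame_bundle Q) s f ->
     derivable (f \o fun t => actS (Defs.rot a t) s) (0 : R) 1).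
Proof.
apply: (generated_curve (actS_rot0 s a)) => [U /(nbh_self rM) Us|].
  by near=> t.
move=> _ [[f sf ->]|[b [X [f [sX sf ->]]]]].
  have -> : (f \o @frames_proj _ _ _ Q) \o (fun t : R => actS (Defs.rot a t) s) =
    cst (f (piS s)) by [].
  exact: derivable_cst.
exact: (@ex_derive _ _ _ _ _ _ _ (is_derive_mcoef_rot s a b X f)).
Unshelve. all: by end_near. Qed.

Lemma fundSE s a f : smooth (frame_bundle Q) s f ->
  fundS a s f = derive1 (f \o fun t => actS (Defs.rot a t) s) 0.
Proof.
by have [nc dc] := rot_curve s a; apply: (velocityE rS) => //; exact: actS_rot0.
Qed.

Lemma dmap_piS_fundS s a : dmap (@piS _ _ _ Q) (fundS a s) = 0.
Proof.
apply: tangent_ext => f sf; rewrite (dmapE rS rM)//; last exact: smooth_piS.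
rewrite fundSE; last exact: (smooth_piS s).1.
have -> : (f \o @piS _ _ _ Q) \o (fun t : R => actS (Defs.rot a t) s) =
  cst (f (piS s)) by [].
by rewrite derive1_cst.
Qed.

Lemma eq_tangent_frames s (X Y : tangent s) :
  (forall f, smooth M (piS s) f -> X (f \o @piS _ _ _ Q) = Y (f \o @piS _ _ _ Q)) ->
  (forall a V f, smooth_vfield (piS s) V -> smooth M (piS s) f ->
     X (mcoef a V f) = Y (mcoef a V f)) -> X = Y.
Proof.
move=> XY1 XY2; apply: (eq_tangent_gens rM frame_bundle_gens_nbh).
move=> _ [[f sf ->]|[a [V [f [sV sf ->]]]]]; [exact: XY1|exact: XY2].
Qed.

Lemma smooth_map_frames (T0 : germSpace R) (phi : T0 -> frame_bundle Q) x :
  regular T0 -> smooth_map (fun y => piS (phi y)) x ->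
  (forall a X f, smooth_vfield (piS (phi x)) X -> smooth M (piS (phi x)) f ->
     smooth T0 x (mcoef a X f \o phi)) -> smooth_map phi x.
Proof.
move=> r0 [spi npi] sm.
apply: (smooth_map_generated (pr := @frames_proj _ _ _ Q) r0) => [U /npi//|].
by move=> _ [[f sf ->]|[a [X [f [sX sf ->]]]]]; [exact: spi|exact: sm].
Qed.

End Frames.

(** * The Swann bundle as a product and its fundamental fields *)

Section SwannBundle.
Context {R : realType} {m : nat} {M : manifold R m} {Q : endsubset M}.
Implicit Types (u : swann_bundle Q).

Let rM : regular M := manifold_regular.
Let rS : regular (frame_bundle Q) := frame_bundle_regular.

Definition swann_gens (u : {posnum R} * frame_bundle Q) :
    set ({posnum R} * frame_bundle Q -> R) := [set g |
  g = (fun v => v.1%:num) \/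
  (exists2 f, smooth (frame_bundle Q) u.2 f & g = f \o snd)].

Lemma swann_gens_nbh u g : swann_gens u g ->
  nbh (frame_bundle Q) u.2
    [set b | forall v : {posnum R} * frame_bundle Q, v.2 = b -> swann_gens v g].
Proof.
move=> [->|[f sf ->]]; first by apply: (nbhT rS) => b v _; left.
by apply: (nbhS rS _ (smooth_nbh rS sf)) => b sb v vb; right; exists f; rewrite ?vb.
Qed.

Lemma swann_regular : regular (swann_bundle Q).
Proof. exact: generated_regular rS swann_gens_nbh. Qed.

Let rW := swann_regular.

Lemma smooth_tcoord u : smooth (swann_bundle Q) u (@tcoord _ _ _ Q).
Proof. by apply: (smooth_gens rS); left. Qed.

Lemma smooth_toS u : smooth_map (@toS _ _ _ Q) u.
Proof.
split=> [f sf|A pA].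
  by apply: (smooth_gens rS); right; exists f.
exact: (nbh_pr (pr := snd) pA).
Qed.

Lemma smooth_pihat u : smooth_map (@pihat _ _ _ Q) u.
Proof. exact: smooth_map_comp (smooth_toS u) (smooth_piS _). Qed.

Lemma dmap_pihatE u (X : tangent u) :
  dmap (@pihat _ _ _ Q) X = dmap (@piS _ _ _ Q) (dmap (@toS _ _ _ Q) X).
Proof. exact: (dmap_comp rW rS rM X (smooth_toS u) (smooth_piS _)). Qed.

Lemma smooth_map_swann (T0 : germSpace R) (phi : T0 -> swann_bundle Q) x :
  regular T0 -> smooth_map (fun y => toS (phi y)) x ->
  smooth T0 x (fun y => tcoord (phi y)) -> smooth_map phi x.
Proof.
move=> r0 [sS nS] st.
apply: (smooth_map_generated (pr := snd) r0) => [U /nS//|].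
by move=> _ [->|[f sf ->]]; [exact: st|exact: sS].
Qed.

Lemma smooth_act g u : smooth_map (@act _ _ _ Q g) u.
Proof.
apply: smooth_map_swann => //.
  exact: smooth_map_comp (smooth_toS u) (smooth_actS _ _).
exact: (smoothZ rW g.1%:num (smooth_tcoord u)).
Qed.

Lemma eq_tangent_swann u (X Y : tangent u) :
  X (@tcoord _ _ _ Q) = Y (@tcoord _ _ _ Q) ->
  dmap (@toS _ _ _ Q) X = dmap (@toS _ _ _ Q) Y -> X = Y.
Proof.
move=> Xt XS; apply: (eq_tangent_gens rS swann_gens_nbh) => _ [->|[f sf ->]] //.
have := congr1 (fun Z : tangent (toS u) => Z f) XS.
by rewrite !(dmapE rW rS)//; exact: smooth_toS.
Qed.

(** Serves both kinds of fundamental fields: a curve is examined through its two components, and its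
    velocity is determined by the derivative of [t] and by the image on [S]. *)
Lemma swann_curve (c : R -> swann_bundle Q) u (d : R) : c 0 = u ->
  (forall N, nbh (frame_bundle Q) (toS u) N ->
     \forall t \near (0 : R), N (toS (c t))) ->
  (forall f, smooth (frame_bundle Q) (toS u) f ->
     derivable (fun t => f (toS (c t))) (0 : R) 1) ->
  is_derive (0 : R) 1 (fun t => tcoord (c t)) d ->
  [/\ forall f, smooth (swann_bundle Q) u f ->
        velocity u c f = derive1 (f \o c) 0,
      velocity u c (@tcoord _ _ _ Q) = d &
      forall f, smooth (frame_bundle Q) (toS u) f ->
        dmap (@toS _ _ _ Q) (velocity u c) f = derive1 (fun t => f (toS (c t))) 0].
Proof.
move=> c0 nc dc [dt <-].
have [nS dS] : (forall A, nbh (swann_bundle Q) u A -> \forall t \near (0 : R), A (c t)) /\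
    (forall f, smooth (swann_bundle Q) u f -> derivable (f \o c) 0 1).
  apply: (generated_curve (pr := snd) c0) => //.
  by move=> _ [->|[f sf ->]]; [exact: dt|exact: dc].
have vE f : smooth (swann_bundle Q) u f ->
    velocity u c f = derive1 (f \o c) 0.
  by move=> sf; apply: (velocityE rW).
split=> // [|f sf].
  by rewrite vE ?derive1E//; exact: smooth_tcoord.
rewrite (dmapE rW rS) ?vE//; [exact: (smooth_toS u).1|exact: smooth_toS].
Qed.

Lemma ZaP a u : Za a u (@tcoord _ _ _ Q) = 0 /\
  dmap (@toS _ _ _ Q) (Za a u) = fundS a (toS u).
Proof.
have [nS dS] := rot_curve (toS u) a.
have c0 : ((u.1, actS (Defs.rot a 0) u.2) : swann_bundle Q) = u.
  by rewrite actS_rot0; case: (u).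
have [_ tE SE] := swann_curve (c := fun t => (u.1, actS (Defs.rot a t) u.2))
  c0 nS dS (is_derive_cst _ _ _).
split=> //; apply: tangent_ext => f sf.
by rewrite SE// fundSE.
Qed.

(** This is the Euler field t d/dt, on which t^-1 dt takes the value 1. *)
Lemma Z0P u : Z0 u (@tcoord _ _ _ Q) = tcoord u /\
  dmap (@toS _ _ _ Q) (Z0 u) = 0.
Proof.
have c0 : (((PosNum (expR_gt0 0))%:num * u.1%:num)%:pos, u.2) = u :> swann_bundle Q.
  case: (u) => t s /=; congr pair; apply/val_inj => /=.
  by rewrite expR0 mul1r.
have nS N : nbh (frame_bundle Q) (toS u) N -> \forall t \near (0 : R), N (toS u).
  by move=> /(nbh_self rS) Nu; near=> t.
have dS f : smooth (frame_bundle Q) (toS u) f ->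
    derivable (fun t : R => f (toS u)) (0 : R) 1.
  by move=> _; exact: derivable_cst.
have dt : is_derive (0 : R) 1 (fun t => expR t * u.1%:num) u.1%:num.
  rewrite (_ : (fun _ => _) = u.1%:num *: expR); last first.
    by apply/funext => t; rewrite mulrC.
  by apply: is_derive_eq (is_deriveZ _ (is_derive_expR 0)) _;
    rewrite expR0 /GRing.scale/= mulr1.
have [_ tE SE] := swann_curve
  (c := fun t => (((PosNum (expR_gt0 t))%:num * u.1%:num)%:pos, u.2))
  c0 nS dS dt.
split=> //; apply: tangent_ext => f sf.
by rewrite SE//; exact: (derive1_cst (f (toS u)) (0 : R)).
Unshelve. all: by end_near. Qed.

End SwannBundle.

(** * Admissible frames and local trivializations *)

Section Admissible.
Context {R : realType} {m : nat} {M : manifold R m}.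
Variables (p : M) (J : 'I_3 -> tangent p -> tangent p).
Hypothesis aJ : admissible J.
Implicit Types (c d : 'I_3 -> R) (x y : tangent p).

Let D a x y : J a (x + y) = J a x + J a y.
Proof. by have [lin _ _] := aJ; rewrite -[x]scale1r lin !scale1r. Qed.

Let J0 a : J a 0 = 0.
Proof. by apply: (addIr (J a 0)); rewrite -D !add0r. Qed.

Let Z a k x : J a (k *: x) = k *: J a x.
Proof. by have [lin _ _] := aJ; rewrite -[k *: x]addr0 lin J0 addr0. Qed.

Let Nn a x : J a (- x) = - J a x.
Proof. by rewrite -scaleN1r Z scaleN1r. Qed.

Lemma admissible_sq a x : J a (J a x) = - x.
Proof. by have [_ + _] := aJ; apply. Qed.

Lemma admissible_sum n a (x : 'I_n -> tangent p) :
  J a (\sum_i x i) = \sum_i J a (x i).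
Proof. exact: (big_morph (J a) (D a) (J0 a)). Qed.

Lemma admissible_scale a k x : J a (k *: x) = k *: J a x.
Proof. exact: Z. Qed.

Lemma admissible01 x : J 0 (J 1 x) = J 2 x.
Proof.
have [_ _ q3] := aJ; apply: oppr_inj.
by rewrite -(q3 (J 2 x)) admissible_sq !Nn.
Qed.

Lemma admissible12 x : J 1 (J 2 x) = J 0 x.
Proof.
have [_ _ q3] := aJ; apply: oppr_inj.
by rewrite -(admissible_sq 0 (J 1 (J 2 x))) q3 Nn.
Qed.

Let J10 x : J 1 (J 0 x) = - J 2 x. Proof. by rewrite -admissible12 admissible_sq. Qed.

Let J02 x : J 0 (J 2 x) = - J 1 x. Proof. by rewrite -admissible01 admissible_sq. Qed.

Let J21 x : J 2 (J 1 x) = - J 0 x. Proof. by rewrite -admissible01 admissible_sq. Qed.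

Lemma admissible20 x : J 2 (J 0 x) = J 1 x.
Proof. by rewrite -admissible01 J10 Nn J02 opprK. Qed.

Lemma admissible_anti a b x : a != b -> J a (J b x) = - J b (J a x).
Proof.
elim/ord3P: a; elim/ord3P: b => //= _;
  by rewrite ?admissible01 ?admissible12 ?J10 ?J02 ?J21 ?admissible20 ?opprK.
Qed.

(** The action on [x] of the imaginary quaternion with components [c]. *)
Definition qcomb c x := \sum_b c b *: J b x.

(** The product of imaginary quaternions: minus the dot product plus the cross product. *)
Lemma qcomb_mul c d x : qcomb c (qcomb d x) =
  - ((\sum_b c b * d b) *: x)
  + (c 1 * d 2 - c 2 * d 1) *: J 0 x
  + (c 2 * d 0 - c 0 * d 2) *: J 1 x
  + (c 0 * d 1 - c 1 * d 0) *: J 2 x.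
Proof.
rewrite /qcomb !sum3 !D !Z !admissible_sq.
rewrite admissible01 J02 J10 admissible12 admissible20 J21.
rewrite !scalerDr !scalerA !scalerN.
(* The nine products are regrouped into the three diagonal ones, which make the dot product, and the
   three pairs that make the cross product. *)
rewrite [LHS](AC (3*3*3) ((1*5*9)*(6*8)*(7*3)*(2*4))).
by rewrite !scalerDl !scaleNr !opprD.
Qed.

Lemma qcombD c d x : qcomb (fun b => c b + d b) x = qcomb c x + qcomb d x.
Proof. by rewrite -big_split; apply: eq_bigr => b _; rewrite scalerDl. Qed.

Lemma qcombZ k c x : qcomb (fun b => k * c b) x = k *: qcomb c x.
Proof. by rewrite scaler_sumr; apply: eq_bigr => b _; rewrite scalerA. Qed.

(* [(k - c) (k + c) = k ^ 2 + |c| ^ 2] in the quaternions *)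
Lemma quaternion_free k c x : x != 0 -> k *: x + qcomb c x = 0 ->
  k = 0 /\ forall b, c b = 0.
Proof.
move=> x0 E.
have E2 : (k ^+ 2 + \sum_b c b * c b) *: x = 0.
  have : k *: (k *: x + qcomb c x) - qcomb c (k *: x + qcomb c x) = 0.
    by rewrite E scaler0 /qcomb big1 ?subrr// => b _; rewrite J0 scaler0.
  have -> : qcomb c (k *: x + qcomb c x) = k *: qcomb c x + qcomb c (qcomb c x).
    rewrite {1}/qcomb; under eq_bigr do rewrite D Z scalerDr.
    rewrite big_split; congr (_ + _); rewrite scaler_sumr.
    by apply: eq_bigr => b _; rewrite !scalerA mulrC.
  rewrite qcomb_mul [c 2 * c 1]mulrC [c 0 * c 2]mulrC [c 1 * c 0]mulrC !subrr.
  rewrite !scale0r !addr0 scalerDr opprD opprK addrA addrK scalerA -expr2 => <-.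
  by rewrite scalerDl.
have {}E2 : k ^+ 2 + \sum_b c b * c b = 0.
  by apply/eqP; move/eqP: E2; rewrite scaler_eq0 (negbTE x0) orbF.
have c0 b : 0 <= c b * c b by rewrite -expr2 sqr_ge0.
have := sqr_ge0 k; have := E2; rewrite sum3 => E3 k0.
have k00 : k ^+ 2 = 0 by have := (c0 0, c0 1, c0 2) => -[[]]; lra.
split; first by apply/eqP; rewrite -sqrf_eq0 k00.
move=> b; apply/eqP; rewrite -[_ == _]orbb -mulf_eq0; apply/eqP.
have := (c0 0, c0 1, c0 2) => -[[]].
by elim/ord3P: b; lra.
Qed.

Lemma qcomb_inj c d x : x != 0 -> qcomb c x = qcomb d x -> c =1 d.
Proof.
move=> x0 E b; apply/eqP; rewrite -subr_eq0; apply/eqP.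
have : 0 *: x + qcomb (fun b => c b + (-1) * d b) x = 0.
  by rewrite qcombD qcombZ E scaleN1r subrr scale0r addr0.
by move=> /(quaternion_free x0)[_ /(_ b)]; rewrite mulN1r.
Qed.

End Admissible.

(** * Transition matrices between admissible frames *)

Section FrameTransition.
Context {R : realType} {m : nat} {M : manifold R m} {Q : endsubset M}.

Lemma frame_coef (p : M) (I J : 'I_3 -> tangent p -> tangent p) :
  admissible_frame Q I -> admissible_frame Q J ->
  exists A : 'I_3 -> 'I_3 -> R, forall a x, I a x = \sum_b A b a *: J b x.
Proof.
move=> [aI sI] [aJ sJ].
have QI a : Q (I a).
  apply/sI; exists (fun b => (a == b)%:R); apply/funext => x.
  rewrite (bigD1 a)//= eqxx scale1r big1 ?addr0// => b ba.
  by rewrite eq_sym (negbTE ba) scale0r.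
have /choice[c Hc] : forall a, exists c : 'I_3 -> R, I a = (fun x => \sum_b c b *: J b x).
  by move=> a; exact/sJ.
by exists (fun b a => c a b) => a x; rewrite Hc.
Qed.

(** The relations of [I], written in [J] and evaluated at one nonzero vector, become relations
    between the columns of [A]: the squares give length 1, the products of distinct members give
    orthogonality, and I_1 I_2 = I_3 makes the third column the cross product of the first two. The
    determinant is then the squared length of the third column. *)
Lemma frame_SO3 (p : M) (I J : 'I_3 -> tangent p -> tangent p)
    (A : 'I_3 -> 'I_3 -> R) (x : tangent p) :
  x != 0 -> admissible I -> admissible J ->
  (forall a x, I a x = \sum_b A b a *: J b x) ->
  exists B : @SO3 R, forall b a, B b a = A b a.
Proof.
move=> x0 aI aJ IE.
pose c a b := A b a.
have IE' a y : I a y = qcomb J (c a) y by rewrite IE.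
(* A product in the frame [I] is read in the frame [J]: linear independence of [x] and the [J b x]
   separates the dot product from the components of the cross product. *)
have prod a b k d : I a (I b x) = k *: x + qcomb I d x ->
  - (\sum_e c a e * c b e) = k /\
  [/\ c a 1 * c b 2 - c a 2 * c b 1 = \sum_e d e * c e 0,
     c a 2 * c b 0 - c a 0 * c b 2 = \sum_e d e * c e 1 &
     c a 0 * c b 1 - c a 1 * c b 0 = \sum_e d e * c e 2].
  have -> : qcomb I d x = qcomb J (fun f => \sum_e d e * c e f) x.
    rewrite /qcomb; under eq_bigr do rewrite IE scaler_sumr.
    rewrite exchange_big; apply: eq_bigr => f _ /=.
    by rewrite scaler_suml; apply: eq_bigr => e _; rewrite scalerA.
  rewrite !IE' (qcomb_mul aJ) => E.
  have : (- (\sum_e c a e * c b e) - k) *: x +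
    qcomb J (fun f => (if f == 0 then c a 1 * c b 2 - c a 2 * c b 1
      else if f == 1 then c a 2 * c b 0 - c a 0 * c b 2
      else c a 0 * c b 1 - c a 1 * c b 0) + (-1) * \sum_e d e * c e f) x = 0.
    rewrite qcombD qcombZ scaleN1r scalerBl.
    rewrite scaleNr.
    apply/eqP; rewrite addrACA -opprD subr_eq0; apply/eqP; rewrite -E.
    by rewrite [X in _ + X = _]sum3 /= !addrA.
  move=> /(quaternion_free aJ x0)[k0 d0].
  split; first by apply/eqP; rewrite -subr_eq0 k0.
  have e0 u v : u + (-1) * v = 0 -> u = v :> R.
    by rewrite mulN1r => /eqP; rewrite subr_eq0 => /eqP.
  by split; apply: e0; [exact: (d0 0)|exact: (d0 1)|exact: (d0 2)].
have sqE a : \sum_e c a e * c a e = 1.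
  have [|+ _] := prod a a (-1) (fun=> 0).
    rewrite (admissible_sq aI) scaleN1r /qcomb big1 ?addr0// => b _.
    by rewrite scale0r.
  by move/oppr_inj.
have delta b k : k *: I b x = 0 *: x + qcomb I (fun f => (b == f)%:R * k) x.
  rewrite scale0r add0r /qcomb (bigD1 b)//= eqxx mul1r big1 ?addr0// => f fb.
  by rewrite eq_sym (negbTE fb) mul0r scale0r.
have mul01 : I 0 (I 1 x) = 1 *: I 2 x by rewrite admissible01// scale1r.
have mul12 : I 1 (I 2 x) = 1 *: I 0 x by rewrite admissible12// scale1r.
have mul20 : I 2 (I 0 x) = 1 *: I 1 x by rewrite admissible20// scale1r.
have [h01 [x0' x1 x2]] := prod _ _ _ _ (etrans mul01 (delta 2 1)).
have [h12 _] := prod _ _ _ _ (etrans mul12 (delta 0 1)).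
have [h20 _] := prod _ _ _ _ (etrans mul20 (delta 1 1)).
have orth : (\matrix_(b, a) A b a)^T *m (\matrix_(b, a) A b a) = 1%:M :> 'M[R]_3.
  apply/matrixP => i j; rewrite !mxE.
  transitivity (\sum_e c i e * c j e).
    by apply: eq_bigr => e _; rewrite !mxE.
  have sym a b : \sum_e c a e * c b e = \sum_e c b e * c a e.
    by apply: eq_bigr => e _; rewrite mulrC.
  have z a b : - (\sum_e c a e * c b e) = 0 -> \sum_e c a e * c b e = 0.
    by move=> /eqP; rewrite oppr_eq0 => /eqP.
  by elim/ord3P : i; elim/ord3P : j; rewrite /= ?sqE// ?(z _ _ h01)//
    ?(z _ _ h12)// ?(z _ _ h20)// sym ?(z _ _ h01)// ?(z _ _ h12)// ?(z _ _ h20).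
have det : \det (\matrix_(b, a) A b a : 'M[R]_3) = 1.
  rewrite -(sqE 2) det3 !mxE; move: x0' x1 x2; rewrite !sum3 /= /c.
  rewrite !mul0r !mul1r !add0r => <- <- <-; ring.
by exists (MkSO3 orth det) => b a; rewrite mxE.
Qed.

End FrameTransition.

(** A skew matrix in the basis ad e_0, ad e_1, ad e_2 of so(3). The entry (e + 2, e + 1) of ad e_e
    is 2 and vanishes for the other two, whence the coefficient with its division by 2. *)
Lemma so3_coordinates (R : realType) (t : 'I_3 -> 'I_3 -> R) b a :
  (forall b a, t b a + t a b = 0) ->
  t b a = \sum_e (t (e + 2) (e + 1) / 2) *
    (if a == e then 0 else if a == e + 1 then 2 * (b == e + 2)%:R
     else - (2 * (b == e + 1)%:R)).
Proof.
move=> anti.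
have e01 : 0 + 1 = 1 :> 'I_3 by exact: val_inj.
have e02 : 0 + 2 = 2 :> 'I_3 by exact: val_inj.
have e11 : 1 + 1 = 2 :> 'I_3 by exact: val_inj.
have e12 : 1 + 2 = 0 :> 'I_3 by exact: val_inj.
have e21 : 2 + 1 = 0 :> 'I_3 by exact: val_inj.
have e22 : 2 + 2 = 1 :> 'I_3 by exact: val_inj.
have t00 := anti 0 0; have t11 := anti 1 1; have t22 := anti 2 2.
have t01 := anti 0 1; have t02 := anti 0 2; have t12 := anti 1 2.
rewrite sum3 !(e01, e02, e11, e12, e21, e22).
by elim/ord3P: a; elim/ord3P: b; rewrite /= ?mulr0 ?mulr1 ?oppr0 ?add0r ?addr0; lra.
Qed.

(** * Local trivializations of S and its vertical vectors *)

Section LocalTrivialization.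
Context {R : realType} {m : nat} {M : manifold R m} {Q : endsubset M}.
Hypothesis m0 : (0 < m)%N.
Implicit Types (s : frame_bundle Q) (c : chart M) (p : M).

Let rM : regular M := manifold_regular.
Let rS : regular (frame_bundle Q) := frame_bundle_regular.

Lemma tangent_nonzero p : exists x : tangent p, x != 0.
Proof.
have [c cp] := chart_cover p.
exists (cfield c (Ordinal m0) p); apply/eqP => E.
have := cfield_coord (Ordinal m0) (Ordinal m0) cp.
by rewrite E tangent0 eqxx => /eqP; rewrite eq_sym oner_eq0.
Qed.

Lemma admissible_chart c p (J : 'I_3 -> tangent p -> tangent p) a x f :
  cdom c p -> admissible J ->
  J a x f = \sum_j x (chart_coord c j) * J a (cfield c j p) f.
Proof.
move=> cp aJ; rewrite {1}(tangent_chart x cp) (admissible_sum aJ) tangent_sum.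
by apply: eq_bigr => j _; rewrite (admissible_scale aJ) tangentZ.
Qed.

(** For distinct indices the two products have equal traces and are opposite, so their trace is 0;
    the squares are -Id on a space of dimension [m]. The coordinate frame of [c] is used to write
    the trace. *)
Lemma trace_admissible c p (J : 'I_3 -> tangent p -> tangent p) a b :
  cdom c p -> admissible J ->
  \sum_i J a (J b (cfield c i p)) (chart_coord c i) = - m%:R * (a == b)%:R.
Proof.
move=> cp aJ; have [<-|ab] := eqVneq a b.
  under eq_bigr do rewrite (admissible_sq aJ) tangentN cfield_coord// eqxx.
  by rewrite sumrN mulr1 sumr_const card_ord.
rewrite mulr0.
have comm : \sum_i J a (J b (cfield c i p)) (chart_coord c i) =
            \sum_i J b (J a (cfield c i p)) (chart_coord c i).
  under eq_bigr do rewrite (admissible_chart _ _ _ cp aJ).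
  under [RHS]eq_bigr do rewrite (admissible_chart _ _ _ cp aJ).
  rewrite exchange_big; apply: eq_bigr => j _; apply: eq_bigr => i _ /=.
  by rewrite mulrC.
have : \sum_i J a (J b (cfield c i p)) (chart_coord c i) =
       - \sum_i J b (J a (cfield c i p)) (chart_coord c i).
  by rewrite -sumrN; apply: eq_bigr => i _; rewrite (admissible_anti aJ).
by rewrite -comm; set t := \sum_i _; lra.
Qed.

(* [J] being orthonormal for the trace form [- tr (A B) / m], these are the
   components of the endomorphisms [I_a] of [s = (I_1, I_2, I_3)] on [J]. *)
Definition frame_component c (J : 'I_3 -> endfield M) b a s : R :=
  - m%:R^-1 *
  \sum_i J b (piS s) (frames_fr a (cfield c i (piS s))) (chart_coord c i).

Lemma frame_componentE c (J : 'I_3 -> endfield M) b a s (A : 'I_3 -> 'I_3 -> R) :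
  cdom c (piS s) -> admissible (J^~ (piS s)) ->
  (forall a x, frames_fr (s := s) a x = \sum_b A b a *: J b (piS s) x) ->
  frame_component c J b a s = A b a.
Proof.
move=> cs aJ IE; rewrite /frame_component.
under eq_bigr do rewrite IE (admissible_sum aJ) tangent_sum.
rewrite exchange_big (bigD1 b)//= [X in _ + X]big1 ?addr0 => [|d db].
  under eq_bigr do rewrite (admissible_scale aJ) tangentZ.
  rewrite -mulr_sumr (trace_admissible b b cs aJ) eqxx mulr1.
  have mN0 : m%:R != 0 :> R by rewrite pnatr_eq0 -lt0n.
  by field.
under eq_bigr do rewrite (admissible_scale aJ) tangentZ.
by rewrite -mulr_sumr (trace_admissible b d cs aJ) eq_sym (negbTE db) !mulr0.
Qed.

(** The gain of the trace formula: expanded in coordinates, it is a sum of products of generators of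
    the germs of [S] with smooth functions of the base point. *)
Lemma smooth_frame_component c (J : 'I_3 -> endfield M) b a s :
  cdom c (piS s) -> smooth_endfield (piS s) (J b) ->
  nbh M (piS s) [set q | admissible (J^~ q)] ->
  smooth (frame_bundle Q) s (frame_component c J b a).
Proof.
move=> cs sJ aJ.
pose h i j := mcoef a (cfield c i) (chart_coord c j) *
  ((fun q => J b q (cfield c j q) (chart_coord c i)) \o @piS _ _ _ Q).
have sh i j : smooth (frame_bundle Q) s (h i j).
  apply: (smoothM rS).
    by apply: smooth_mcoef; [exact: smooth_cfield|exact: smooth_coord].
  apply: (smooth_piS s).1; apply: sJ; last exact: smooth_coord.
  exact: smooth_cfield.
have := smoothZ rS (- m%:R^-1) (smooth_sum rS (fun i => smooth_sum rS (sh i))).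
apply: (eq_smooth rS).
have ncs := (smooth_piS s).2 _ (cdom_nbhs cs).
have naJ := (smooth_piS s).2 _ aJ.
apply: (nbhS rS _ (nbhI rS ncs naJ)) => s' [/= cs' aJ'].
congr (_ * _); apply: eq_bigr => i _.
by rewrite (admissible_chart _ _ _ cs' aJ').
Qed.

Hypothesis aQ : almost_quaternionic Q.

(** The local frame given by [almost_quaternionic] is rotated by a constant matrix so as to pass
    through [s]. The functions [T] are then the entries of the transition matrix, and they describe
    entire fibres over a neighbourhood, not only frames close to [s]. *)
Lemma local_trivialization s : exists (J : 'I_3 -> endfield M)
    (T : 'I_3 -> 'I_3 -> frame_bundle Q -> R),
  [/\ forall a, smooth_endfield (piS s) (J a),
      forall b a, smooth (frame_bundle Q) s (T b a),
      forall a, J a (piS s) = frames_fr a &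
      nbh M (piS s) [set q | admissible_frame Q (J^~ q) /\
        forall s', piS s' = q ->
          [/\ admissible_frame Q (J^~ (piS s')),
           forall a x, frames_fr (s := s') a x = \sum_b T b a s' *: J b (piS s') x &
           forall a d, \sum_b T b a s' * T b d s' = (a == d)%:R]]].
Proof.
have [J [sJ nJ]] := aQ (piS s).
have [c cs] := chart_cover (piS s).
have fJ := nbh_self rM nJ.
have [A HA] := frame_coef (frP (projT2 s)) fJ.
have [x x0] := tangent_nonzero (piS s).
have [B HB] := frame_SO3 x0 (frP (projT2 s)).1 fJ.1 HA.
pose K a q := rotate B (J^~ q) a.
have nK : nbh M (piS s) [set q | admissible_frame Q (K^~ q)].
  by apply: (nbhS rM _ nJ) => q fJq; exact: (rotateP B (Frame fJq)).
have sK a : smooth_endfield (piS s) (K a).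
  move=> X sX; apply: (smooth_vfield_sum rM) => b.
  apply: (smooth_vfieldZ rM); first exact: (smooth_cst rM).
  exact: sJ.
exists K, (frame_component c K); split=> //.
- move=> b a; apply: smooth_frame_component => //.
  by apply: (nbhS rM _ nK) => q [].
- move=> a; apply/funext => y; rewrite /frames_fr HA.
  by apply: eq_bigr => b _; rewrite HB.
- apply: (nbhS rM _ (nbhI rM nK (cdom_nbhs cs))) => q [/= fq cq].
  split=> // s' s'q; rewrite -s'q in fq cq.
  have [A' HA'] := frame_coef (frP (projT2 s')) fq.
  have [y y0] := tangent_nonzero (piS s').
  have [B' HB'] := frame_SO3 y0 (frP (projT2 s')).1 fq.1 HA'.
  have E b a : frame_component c K b a s' = A' b a.
    exact: frame_componentE cq fq.1 HA'.
  split=> // [a z|a d].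
    by rewrite [LHS]HA'; apply: eq_bigr => b _; rewrite E.
  by rewrite -(SO3_col B'); apply: eq_bigr => b _; rewrite !HB' !E.
Qed.

Lemma frame_section s : exists J : forall p, frame Q p,
  sectionS J (piS s) = s /\ smooth_map (sectionS J) (piS s).
Proof.
have [J [T [sJ _ Js nJ]]] := local_trivialization s.
have FQ p : exists I : frame Q p, True.
  have [K [_ nK]] := aQ p.
  by exists (Frame (nbh_self rM nK)).
(* A section has to be total: where [J] fails to be a frame of [Q], which does not happen near
   [piS s], an arbitrary frame is chosen. *)
pose F p : frame Q p :=
  if pselect (admissible_frame Q (J^~ p)) is left h then Frame h
  else sval (cid (FQ p)).
have FE p : admissible_frame Q (J^~ p) -> fr (F p) = J^~ p.
  by rewrite /F; case: pselect.
exists F; split.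
  have /FE Fp := (nbh_self rM nJ).1.
  rewrite /sectionS; case: (s) Js Fp => p I /= Js Fp.
  congr existT; apply: frame_eq; rewrite Fp; apply/funext => a; exact: Js.
apply: (smooth_map_frames (T0 := M) rM) => [|a X f sX sf]; first by split.
have := sJ a X sX f sf; apply: (eq_smooth rM).
apply: (nbhS rM _ nJ) => q [/FE Fq _] /=.
by rewrite /mcoef /frames_fr /= Fq.
Qed.

(** A generator of the germs of [S] is either a function of the base point, which vertical vectors
    kill, or a matrix coefficient, which is a combination of the [T b a] with functions of the base
    point as coefficients. *)
Lemma eq_vertical s (X Y : tangent s) (J : 'I_3 -> endfield M)
    (T : 'I_3 -> 'I_3 -> frame_bundle Q -> R) :
  dmap (@piS _ _ _ Q) X = 0 -> dmap (@piS _ _ _ Q) Y = 0 ->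
  (forall a, smooth_endfield (piS s) (J a)) ->
  (forall b a, smooth (frame_bundle Q) s (T b a)) ->
  nbh M (piS s) [set q | forall s', piS s' = q ->
    forall a x, frames_fr (s := s') a x = \sum_b T b a s' *: J b (piS s') x] ->
  (forall b a, X (T b a) = Y (T b a)) -> X = Y.
Proof.
move=> X0 Y0 sJ sT nT XY.
have V0 (Z : tangent s) f : dmap (@piS _ _ _ Q) Z = 0 -> smooth M (piS s) f ->
    Z (f \o @piS _ _ _ Q) = 0.
  by move=> Z0 sf; rewrite -(dmapE rS rM) ?Z0//; exact: smooth_piS.
apply: eq_tangent_frames => [f sf|a V f sV sf]; first by rewrite !V0.
pose h b := T b a * ((fun q => J b q (V q) f) \o @piS _ _ _ Q).
have sJV b : smooth M (piS s) (fun q => J b q (V q) f) by exact: sJ.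
have sJV' b := (smooth_piS s).1 _ (sJV b).
have sh b : smooth (frame_bundle Q) s (h b).
  exact: smoothM rS _ _ _ (sT b a) (sJV' b).
have E : nbh (frame_bundle Q) s [set s' | mcoef a V f s' = \sum_b h b s'].
  have nT' := (smooth_piS s).2 _ nT.
  apply: (nbhS rS _ nT') => s' /= /(_ s' erefl) fE.
  by rewrite /mcoef fE tangent_sum.
have sm : smooth (frame_bundle Q) s (mcoef a V f) by exact: smooth_mcoef.
rewrite !(der_local rS _ sm E) !(der_sum rS)//; apply: eq_bigr => b _.
by rewrite !(derM _ (sT b a) (sJV' b)) XY (V0 X)// (V0 Y).
Qed.

(** The transition matrix [T] identifies the fibre with SO(3), sending [s] to the identity. A
    vertical vector differentiates [T] to a skew matrix, and the fundamental fields differentiate it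
    to the basis ad e_a of the skew matrices. *)
Lemma vertical_fundS s (X : tangent s) : dmap (@piS _ _ _ Q) X = 0 ->
  exists xi : 'I_3 -> R, X = \sum_a xi a *: fundS a s.
Proof.
move=> X0.
have [J [T [sJ sT Js nJ]]] := local_trivialization s.
have [fJ _] := nbh_self rM nJ.
(* Valid for every rotation, since the trivialization covers the whole fibre; the coefficients in a
   frame are unique by evaluation at a nonzero vector. *)
have Tact (A : @SO3 R) b a : T b a (actS A s) = A b a.
  have [_ /(_ (actS A s) erefl)[_ TE _]] := nbh_self rM nJ.
  have [x x0] := tangent_nonzero (piS s).
  have : qcomb (J^~ (piS s)) (fun b => T b a (actS A s)) x =
         qcomb (J^~ (piS s)) (fun b => A b a) x.
    rewrite -[LHS](TE a x); apply: eq_bigr => d _.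
    by rewrite Js.
  by move/(qcomb_inj fJ.1 x0); exact.
have T1 b a : T b a s = (b == a)%:R.
  have := Tact (Defs.rot 0 0) b a; rewrite actS_rot0 => ->.
  by rewrite mxE mulr0 cos0 sin0; elim/ord3P : a; elim/ord3P: b;
    rewrite /= ?mulr1 ?mulr0 ?addr0 ?add0r ?oppr0 ?mul0r.
have fundT e b a : fundS e s (T b a) =
    if a == e then 0 else if a == e + 1 then 2 * (b == e + 2)%:R
    else - (2 * (b == e + 1)%:R).
  rewrite fundSE// derive1E.
  have -> : T b a \o (fun t => actS (Defs.rot e t) s) = fun t => rot_mx e t b a.
    by apply/funext => t; rewrite /= Tact.
  by have [_ ] := is_derive_rot R e b a.
(* The orthonormality of the columns of [T], differentiated where [T] is the identity. *)
have anti b a : X (T b a) + X (T a b) = 0.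
  have E : nbh (frame_bundle Q) s
      [set s' | \sum_d (T d b * T d a) s' = (b == a)%:R].
    apply: (nbhS rS _ ((smooth_piS s).2 _ nJ)) => s' [_ /(_ s' erefl)[_ _ O]].
    exact: O.
  have sTT d : smooth (frame_bundle Q) s (T d b * T d a) by exact: smoothM.
  have := der_local rS X (smooth_sum rS sTT) E.
  rewrite (der_cst rS) (der_sum rS)// => <-.
  under eq_bigr do rewrite (derM _ (sT _ _) (sT _ _)) !T1.
  rewrite big_split /= addrC; congr (_ + _).
    rewrite (bigD1 b)//= eqxx mul1r big1 ?addr0// => d db.
    by rewrite (negbTE db) mul0r.
  rewrite (bigD1 a)//= eqxx mulr1 big1 ?addr0// => d da.
  by rewrite (negbTE da) mulr0.
exists (fun a => X (T (a + 2) (a + 1)) / 2).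
apply: (eq_vertical X0 _ sJ sT).
- apply: (tangent_ext) => f sf; rewrite (dmapE rS rM)//; last exact: smooth_piS.
  rewrite tangent_sum big1 // => a _.
  rewrite tangentZ -(dmapE rS rM) ?dmap_piS_fundS ?tangent0 ?mulr0//.
  exact: smooth_piS.
- by apply: (nbhS rM _ nJ) => q [_ Hq] s' /Hq[].
- move=> b a; rewrite tangent_sum (so3_coordinates (t := fun b a => X (T b a)) b a anti).
  by apply: eq_bigr => e _; rewrite tangentZ fundT.
Qed.

End LocalTrivialization.

(** * Horizontal vectors and the pulled back form *)

Section OneForms.
Context {R : realType} {m : nat} {M : manifold R m} {Q : endsubset M}.
Hypotheses (m0 : (0 < m)%N) (aQ : almost_quaternionic Q).
Variable theta : 'I_3 -> form1 (frame_bundle Q).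
Hypothesis theta_form : forall a, is_form1 (theta a).
Hypothesis theta_fundS : forall a b s, theta a (fundS b s) = (a == b)%:R.
Implicit Types u : swann_bundle Q.

Let rM : regular M := manifold_regular.
Let rS : regular (frame_bundle Q) := frame_bundle_regular.
Let rW : regular (swann_bundle Q) := swann_regular.
Let pi := @pihat _ _ _ Q.

Lemma pihat_onto u (x : tangent (pihat u)) : exists X : tangent u, dmap pi X = x.
Proof.
have [J [Ju sJ]] := frame_section m0 aQ (toS u).
pose phi (q : M) : swann_bundle Q := (u.1, sectionS J q).
have phiu : phi (pihat u) = u by rewrite /phi [sectionS J _]Ju; case: (u).
have : smooth_map phi (pihat u).
  apply: (smooth_map_swann (T0 := M) rM) => //.
  exact: (smooth_cst rM).
rewrite /smooth_map phiu => -[sphi nphi].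
(* The lift is the image of [x] under the differential of [phi]. As [phi (pihat u)] equals [u] only
   propositionally, [dmap phi x] has another type, so the derivation is rebuilt at [u]. *)
have XE f : smooth (swann_bundle Q) u f ->
    mk_tangent u (fun f => x (f \o phi)) f = x (f \o phi).
  apply: (mk_tangentE rW).
  - move=> {}f g sf sg fg; apply: (der_local rM); first exact: sphi.
    exact: nphi fg.
  - by move=> a {}f g sf sg; exact: (der_lin _ a (sphi f sf) (sphi g sg)).
  - move=> {}f g sf sg; have := derM x (sphi f sf) (sphi g sg).
    by rewrite /= phiu.
exists (mk_tangent u (fun f => x (f \o phi))).
apply: tangent_ext => f sf; rewrite (dmapE rW rM)//; last exact: smooth_pihat.
by rewrite XE//; exact: (smooth_pihat u).1.
Qed.

Lemma theta_linear a (s : frame_bundle Q) (k : R) (x y : tangent s) :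
  theta a (k *: x + y) = k * theta a x + theta a y.
Proof. exact: (theta_form a).1. Qed.

Lemma theta_sum a (s : frame_bundle Q) n (k : 'I_n -> R) (x : 'I_n -> tangent s) :
  theta a (\sum_i k i *: x i) = \sum_i k i * theta a (x i).
Proof.
have lin : linear (theta a (p := s) : _ -> R^o) by move=> ? ? ?; exact: theta_linear.
pose L : {linear tangent s -> R^o} :=
  HB.pack (theta a (p := s) : _ -> R^o) (GRing.isLinear.Build _ _ _ _ _ lin).
rewrite -[LHS]/(L _) linear_sum; apply: eq_bigr => i _.
by rewrite linearZ.
Qed.

Lemma theta0 a (s : frame_bundle Q) : theta a (0 : tangent s) = 0.
Proof.
have := theta_sum a (fun i : 'I_0 => 0) (fun i : 'I_0 => 0 : tangent s).
by rewrite !big_ord0.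
Qed.

Lemma vertical_theta0 (s : frame_bundle Q) (X : tangent s) :
  dmap (@piS _ _ _ Q) X = 0 -> (forall a, theta a X = 0) -> X = 0.
Proof.
move=> /(vertical_fundS m0 aQ)[xi ->] t0.
rewrite big1 // => a _; have := t0 a.
rewrite theta_sum (bigD1 a)//= theta_fundS eqxx mulr1 big1 ?addr0 => [->|b ba].
  by rewrite scale0r.
by rewrite theta_fundS eq_sym (negbTE ba) mulr0.
Qed.

(** The image on [S] is a combination of fundamental fields whose coefficients are its values under
    [theta], all zero; the component along R_+ vanishes because t is nonzero. *)
Lemma horizontal_vertical u (X : tangent u) :
  horizontal theta X -> dmap pi X = 0 -> X = 0.
Proof.
move=> [X0 Xa] dX.
have toS0 : dmap (@toS _ _ _ Q) X = 0.
  by apply: vertical_theta0 => //; rewrite -dmap_pihatE.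
have t0 : tcoord u != 0 by rewrite /tcoord gt_eqF.
apply: eq_tangent_swann.
  move/eqP: X0; rewrite /thetahat0 mulf_eq0 invr_eq0 (negbTE t0) => /eqP ->.
  by rewrite tangent0.
rewrite toS0; apply/esym/tangent_ext => f sf.
by rewrite (dmapE rW rS)//; exact: smooth_toS.
Qed.

(** One expansion for the three kinds of linear maps applied to [hproj]: the differential of the
    projection, t^-1 dt and the components of theta. *)
Lemma hproj_linear (W : lmodType R) u (X : tangent u) (f : tangent u -> W) :
  linear f -> f (hproj theta X) =
    f X - thetahat0 X *: f (Z0 u) - \sum_a thetahat theta a X *: f (Za a u).
Proof.
move=> lin.
pose L : {linear tangent u -> W} := HB.pack f (GRing.isLinear.Build _ _ _ _ _ lin).
rewrite -[LHS]/(L _) /hproj !linearB linearZ linear_sum; congr (_ - _).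
by apply: eq_bigr => a _; rewrite linearZ.
Qed.

Lemma dmap_Za a u : dmap pi (Za a u) = 0.
Proof. by rewrite /pi dmap_pihatE (ZaP a u).2 dmap_piS_fundS. Qed.

Lemma dmap_Z0 u : dmap pi (Z0 u) = 0.
Proof.
rewrite /pi dmap_pihatE (Z0P u).2; apply: tangent_ext => f sf.
by rewrite (dmapE rS rM)//; exact: smooth_piS.
Qed.

Lemma dmap_hproj u (X : tangent u) : dmap pi (hproj theta X) = dmap pi X.
Proof.
rewrite (@hproj_linear _ u X (@dmap _ _ _ pi u)).
  rewrite dmap_Z0 scaler0 subr0 big1 ?subr0// => a _.
  by rewrite dmap_Za scaler0.
by move=> a x y; apply: (dmap_linear rW rM); exact: smooth_pihat.
Qed.

Lemma horizontal_hproj u (X : tangent u) : horizontal theta (hproj theta X).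
Proof.
have t0 : tcoord u != 0 by rewrite /tcoord gt_eqF.
split.
  rewrite (@hproj_linear R^o u X (@thetahat0 _ _ _ _ u)).
    rewrite big1 => [|a _]; last by rewrite /thetahat0 (ZaP a u).1 mulr0 scaler0.
    by rewrite {3}/thetahat0 (Z0P u).1 mulVf// /GRing.scale/= mulr1 subrr subr0.
  by move=> k x y; rewrite /thetahat0 tangentD tangentZ mulrDr mulrCA.
move=> a; rewrite (@hproj_linear R^o u X (@thetahat _ _ _ _ theta a u)).
  rewrite {2}/thetahat (Z0P u).2 theta0 scaler0 subr0 (bigD1 a)//= big1 => [|b ba].
    rewrite [X in _ - (_ *: X + _)]/thetahat (ZaP a u).2 theta_fundS eqxx.
    by rewrite /GRing.scale/= mulr1 addr0 subrr.
  by rewrite {2}/thetahat (ZaP b u).2 theta_fundS eq_sym (negbTE ba) scaler0.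
move=> k x y; rewrite /thetahat (dmap_linear rW rS) ?theta_linear//.
exact: smooth_toS.
Qed.

Lemma horizontal_onto u (x : tangent (pihat u)) :
  exists X : tangent u, horizontal theta X /\ dmap pi X = x.
Proof.
have [X <-] := pihat_onto x.
by exists (hproj theta X); split; [exact: horizontal_hproj|exact: dmap_hproj].
Qed.

(** The default 0 of [xget] is not taken, because a horizontal preimage exists. *)
Lemma dmap_hlift u (x : tangent (pihat u)) : dmap pi (hlift theta x) = x.
Proof. by have [_] := xgetPex 0 (horizontal_onto x). Qed.

Lemma hproj_horizontal u (X : tangent u) : horizontal theta X -> hproj theta X = X.
Proof.
move=> [X0 Xa]; rewrite /hproj X0 scale0r subr0 big1 ?subr0// => a _.
by rewrite Xa scale0r.
Qed.

(** On a horizontal vector the coefficients of all vertical terms of [Ihat] vanish. That [Ihat a]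
    covers the member [a] of the frame at [u] reduces the Hermitian property to that of omega. *)
Lemma dmap_Ihat a u (X : tangent u) : horizontal theta X ->
  dmap pi (Ihat theta a X) = frames_fr (s := toS u) a (dmap pi X).
Proof.
move=> /[dup] hX [X0 Xa]; rewrite /Ihat X0 (Xa a) (Xa (a + 1)) (Xa (a + 2)).
rewrite !scale0r !oppr0 !add0r.
by rewrite hproj_horizontal// dmap_hlift.
Qed.

End OneForms.

(** * Coordinate expansion and closedness of the pullback *)

Section Pullback.
Context {R : realType} {m : nat} {M : manifold R m} {Q : endsubset M}.
Variable omega : form2 M.
Hypothesis omega_form : is_form2 (TT M) omega.
Implicit Types u : swann_bundle Q.

Let rM : regular M := manifold_regular.
Let rW : regular (swann_bundle Q) := swann_regular.
Let pi := @pihat _ _ _ Q.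
Let omegahat : form2 (swann_bundle Q) := pullback pi omega.

Lemma form2_anti p (x y : tangent p) : omega x y = - omega y x.
Proof. by have [_ + _] := omega_form; apply. Qed.

Lemma form2_linear p (a : R) (x y z : tangent p) :
  omega (a *: x + y) z = a * omega x z + omega y z.
Proof. by have [+ _ _] := omega_form; apply. Qed.

Lemma form2_suml p n (k : 'I_n -> R) (x : 'I_n -> tangent p) z :
  omega (\sum_i k i *: x i) z = \sum_i k i * omega (x i) z.
Proof.
have lin : linear (fun x => omega x z : R^o) by move=> ? ? ?; exact: form2_linear.
pose L : {linear tangent p -> R^o} :=
  HB.pack (fun x => omega x z : R^o) (GRing.isLinear.Build _ _ _ _ _ lin).
rewrite -[LHS]/(L _) linear_sum; apply: eq_bigr => i _.
by rewrite linearZ.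
Qed.

Lemma form2_sumr p n (k : 'I_n -> R) (x : 'I_n -> tangent p) z :
  omega z (\sum_i k i *: x i) = \sum_i k i * omega z (x i).
Proof.
rewrite form2_anti form2_suml -sumrN; apply: eq_bigr => i _.
by rewrite -mulrN -form2_anti.
Qed.

Lemma form2_0l p (y : tangent p) : omega 0 y = 0.
Proof.
have := form2_suml (fun i : 'I_0 => 0) (fun i : 'I_0 => 0 : tangent p) y.
by rewrite !big_ord0.
Qed.

Lemma pullback_anti u (x y : tangent u) : omegahat x y = - omegahat y x.
Proof. exact: form2_anti. Qed.

Lemma pullback_linear u (a : R) (x y z : tangent u) :
  omegahat (a *: x + y) z = a * omegahat x z + omegahat y z.
Proof.
rewrite /omegahat /pullback (dmap_linear rW rM) ?form2_linear//.
exact: smooth_pihat.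
Qed.

Definition form_coef (c : chart M) i j (p : M) : R :=
  omega (cfield c i p) (cfield c j p).

Lemma smooth_form_coef c i j p : cdom c p -> smooth M p (form_coef c i j).
Proof.
move=> cp; have [_ _ so] := omega_form.
by apply: so; split; do ?exact: smooth_cfield; exact: (nbhT rM).
Qed.

Definition lift_coord (c : chart M) i : swann_bundle Q -> R := chart_coord c i \o pi.

Lemma smooth_lift_coord c i u : cdom c (pihat u) ->
  smooth (swann_bundle Q) u (lift_coord c i).
Proof. by move=> cu; apply: (smooth_pihat u).1; exact: smooth_coord. Qed.

Lemma pullback_chart c u (x y : tangent u) : cdom c (pihat u) ->
  omegahat x y = \sum_i \sum_j x (lift_coord c i) * y (lift_coord c j) *
                   form_coef c i j (pihat u).
Proof.
move=> cu; rewrite /omegahat /pullback.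
rewrite (tangent_chart (dmap pi x) cu) (tangent_chart (dmap pi y) cu).
rewrite form2_suml; apply: eq_bigr => i _.
rewrite form2_sumr mulr_sumr; apply: eq_bigr => j _.
rewrite !(dmapE rW rM) ?mulrA//; do ?exact: smooth_pihat; exact: smooth_coord.
Qed.

Section AtPoint.
Variables (c : chart M) (u : swann_bundle Q).
Hypothesis cu : cdom c (pihat u).

Let near_chart : nbh (swann_bundle Q) u [set v | cdom c (pihat v)].
Proof. exact: (smooth_pihat u).2 (cdom_nbhs cu). Qed.

Let term (Y Z : vfield (swann_bundle Q)) i j : swann_bundle Q -> R :=
  (fun v => Y v (lift_coord c i)) * (fun v => Z v (lift_coord c j)) *
  (form_coef c i j \o pi).

Let near_term Y Z : nbh (swann_bundle Q) u
  [set v | \sum_i \sum_j term Y Z i j v = omegahat (Y v) (Z v)].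
Proof. by apply: (nbhS rW _ near_chart) => v cv; rewrite /= (pullback_chart _ _ cv). Qed.

Let smooth_field Y i : smooth_vfield u Y ->
  smooth (swann_bundle Q) u (fun v => Y v (lift_coord c i)).
Proof. by apply; exact: smooth_lift_coord. Qed.

Let smooth_coef i j : smooth (swann_bundle Q) u (form_coef c i j \o pi).
Proof. by apply: (smooth_pihat u).1; exact: smooth_form_coef. Qed.

Let smooth_term Y Z i j : smooth_vfield u Y -> smooth_vfield u Z ->
  smooth (swann_bundle Q) u (term Y Z i j).
Proof.
move=> sY sZ; apply: (smoothM rW) (smooth_coef i j).
by apply: (smoothM rW); exact: smooth_field.
Qed.

Lemma smooth_pullback Y Z : smooth_vfield u Y -> smooth_vfield u Z ->
  smooth (swann_bundle Q) u (fun v => omegahat (Y v) (Z v)).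
Proof.
move=> sY sZ; apply: (eq_smooth rW (near_term Y Z)).
apply: (smooth_sum rW) => i; apply: (smooth_sum rW) => j.
exact: smooth_term.
Qed.

(** The first double sum differentiates the components of the fields. The second differentiates the
    coefficients of omega, which are functions on [M] and hence see only the image of [x] under d
    pi. *)
Lemma der_pullback (x : tangent u) Y Z : smooth_vfield u Y -> smooth_vfield u Z ->
  x (fun v => omegahat (Y v) (Z v)) =
  \sum_i \sum_j
    (x (fun v => Y v (lift_coord c i)) * Z u (lift_coord c j) +
     Y u (lift_coord c i) * x (fun v => Z v (lift_coord c j))) *
    form_coef c i j (pihat u) +
  \sum_i \sum_j Y u (lift_coord c i) * Z u (lift_coord c j) *
    \sum_k x (lift_coord c k) * cfield c k (pihat u) (form_coef c i j).
Proof.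
move=> sY sZ.
have sT i j := smooth_term i j sY sZ.
rewrite -(der_local rW x _ (near_term Y Z)); last first.
  by apply: (smooth_sum rW) => i; exact: (smooth_sum rW).
rewrite (der_sum rW) => [|i]; last exact: (smooth_sum rW).
rewrite -big_split; apply: eq_bigr => i _.
rewrite (der_sum rW)// -big_split; apply: eq_bigr => j _ /=.
have sYi := smooth_field i sY; have sZj := smooth_field j sZ.
rewrite (derM _ (smoothM rW sYi sZj) (smooth_coef i j)) (derM _ sYi sZj).
congr (_ + _ * _).
rewrite -(dmapE rW rM); [|exact: smooth_pihat|exact: smooth_form_coef].
rewrite {1}(tangent_chart (dmap pi x) cu) tangent_sum; apply: eq_bigr => k _.
rewrite tangentZ (dmapE rW rM)//; [exact: smooth_pihat|exact: smooth_coord].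
Qed.

End AtPoint.

Variable nabla : covariant M.
Hypotheses (tf : torsion_free nabla) (par : parallel_form nabla omega).

(* Torsion-freeness makes the Christoffel terms symmetric, since coordinate
   fields commute; they cancel in the cyclic sum. *)
Lemma form_coef_closed c i j k p : cdom c p ->
  cfield c i p (form_coef c j k) - cfield c j p (form_coef c i k) +
  cfield c k p (form_coef c i j) = 0.
Proof.
move=> cp; have sc l := smooth_cfield l cp.
pose G a b := nabla (cfield c a p) (cfield c b).
have Gsym a b : G a b = G b a.
  apply/eqP; rewrite -subr_eq0 /G; apply/eqP.
  by rewrite (tf (sc a) (sc b)) bracket_cfield.
pose g a b d : R := omega (G a b) (cfield c d p).
have gsym a b d : g a b d = g b a d by rewrite /g Gsym.
have E a b d : cfield c a p (form_coef c b d) = g a b d - g a d b.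
  by rewrite [LHS](par _ (sc b) (sc d)) (form2_anti (cfield c b p)).
rewrite [X in X - _ + _](E i j k) [X in _ - X + _](E j i k) [X in _ + X](E k i j).
by clearbody g; rewrite (gsym j i) (gsym k i) (gsym k j); ring.
Qed.

(** [B] collects the terms with derivatives of the fields and [C] those with derivatives of the
    coefficients of omega. The brackets are commutators of the same component derivatives, so the
    [B] terms cancel by antisymmetry; the [C] terms cancel because omega is closed on coordinate
    fields. *)
Lemma koszul_pullback u X Y Z : smooth_vfield u X -> smooth_vfield u Y ->
  smooth_vfield u Z -> koszul (fun _ => id) omegahat X Y Z u = 0.
Proof.
move=> sX sY sZ; have [c cu] := chart_cover (pihat u).
pose B (a b : 'I_m -> R) := \sum_i \sum_j a i * b j * form_coef c i j (pihat u).
pose C (a b d : 'I_m -> R) := \sum_i \sum_j b i * d j *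
  \sum_k a k * cfield c k (pihat u) (form_coef c i j).
pose co (x : tangent u) i := x (lift_coord c i).
pose dc (x : tangent u) (Y : vfield (swann_bundle Q)) i :=
  x (fun v => Y v (lift_coord c i)).
have BA a b : B a b = - B b a.
  rewrite /B -sumrN exchange_big; apply: eq_bigr => i _ /=.
  rewrite -sumrN; apply: eq_bigr => j _.
  rewrite {1}/form_coef form2_anti -/(form_coef c i j (pihat u)); ring.
have BB a a' b : B (fun i => a i - a' i) b = B a b - B a' b.
  rewrite /B -sumrB; apply: eq_bigr => i _; rewrite -sumrB.
  by apply: eq_bigr => j _; ring.
have dE (x : tangent u) V W : smooth_vfield u V -> smooth_vfield u W ->
    x (fun v => omegahat (V v) (W v)) =
    B (dc x V) (co (W u)) + B (co (V u)) (dc x W) +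
    C (co x) (co (V u)) (co (W u)).
  move=> sV sW; rewrite (der_pullback cu)//; congr (_ + _).
  rewrite /B -big_split; apply: eq_bigr => i _; rewrite -big_split.
  by apply: eq_bigr => j _ /=; rewrite mulrDl.
have bE V W x : smooth_vfield u V -> smooth_vfield u W ->
    omegahat (bracket V W u) x = B (fun i => dc (V u) W i - dc (W u) V i) (co x).
  move=> sV sW; rewrite (pullback_chart _ _ cu); apply: eq_bigr => i _.
  apply: eq_bigr => j _.
  by rewrite (bracketE rW sV sW)//; exact: smooth_lift_coord.
have C0 a b d : C a b d - C b a d + C d a b = 0.
  have CE a' b' d' : C a' b' d' = \sum_i \sum_j \sum_k
      a' i * b' j * d' k * cfield c i (pihat u) (form_coef c j k).
    rewrite /C; under eq_bigr do under eq_bigr do rewrite mulr_sumr.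
    under eq_bigr do rewrite exchange_big.
    rewrite exchange_big; apply: eq_bigr => i _; apply: eq_bigr => j _.
    by apply: eq_bigr => k _; ring.
  have aux (x y z w1 w2 w3 : R) : w1 - w2 + w3 = 0 ->
      x * y * z * w1 - y * x * z * w2 + z * x * y * w3 = 0.
    move=> E; transitivity (x * y * z * (w1 - w2 + w3)); first by ring.
    by rewrite E mulr0.
  rewrite !CE [X in _ - X + _]exchange_big.
  rewrite [X in _ + X]exchange_big /=; under [X in _ + X]eq_bigr do rewrite exchange_big.
  rewrite -sumrB -big_split big1 // => i _; rewrite -sumrB -big_split big1 // => j _.
  rewrite -sumrB -big_split big1 // => k _ /=.
  exact: aux (form_coef_closed i j k cu).
rewrite /koszul !dE// !bE// !BB.
have := C0 (co (X u)) (co (Y u)) (co (Z u)).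
have := BA (dc (X u) Z) (co (Y u)); have := BA (dc (Y u) Z) (co (X u)).
have := BA (dc (Z u) Y) (co (X u)).
lra.
Qed.

End Pullback.

(** * Restriction of forms to a distribution, and the conclusion *)

Lemma is_form2_sub (R : realType) (T : germSpace R) (D : tdistribution T) (w : form2 T) :
  regular T -> is_form2 (TT T) w -> is_form2 D w.
Proof.
move=> rT [lin anti sm]; split=> [p a x y z _ _ _|p x y _ _|p X Y [sX _] [sY _]].
- exact: lin.
- exact: anti.
- by apply: sm; split=> //; exact: (nbhT rT).
Qed.

Lemma is_form3_sub (R : realType) (T : germSpace R) (D : tdistribution T) (w : form3 T) :
  regular T -> is_form3 (TT T) w -> is_form3 D w.
Proof.
move=> rT [lin anti sm]; split=> [p a x y z t _ _ _ _|p x y z _ _ _|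
    p X Y Z [sX _] [sY _] [sZ _]].
- exact: lin.
- exact: anti.
- by apply: sm; split=> //; exact: (nbhT rT).
Qed.

Lemma is_form3_0 (R : realType) (T : germSpace R) (D : tdistribution T) :
  regular T -> is_form3 D (form3_0 T).
Proof.
move=> rT; split=> [p a x y z t _ _ _ _|p x y z _ _ _|p X Y Z _ _ _].
- by rewrite /form3_0 mulr0 addr0.
- by rewrite /form3_0 oppr0.
- exact: (smooth_cst rT).
Qed.

Theorem proposition3p6 (R : realType) (n : nat) (M : manifold R (4 * n))
    (Q : endsubset M) (omega : form2 M) (nabla : covariant M)
    (theta : 'I_3 -> form1 (frame_bundle Q)) :
  (1 < n)%N ->
  quaternionic_skew_Hermitian Q omega nabla ->
  induced_connection nabla theta ->
  let omegahat : form2 (swann_bundle Q) := pullback (@pihat R _ M Q) omega in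
  let H : tdistribution (swann_bundle Q) := horizontal theta in
  [/\ is_form2 (TT (swann_bundle Q)) omegahat,
      horizontal_form omegahat,
      invariant_form omegahat,
      closed_form omegahat &
      forall u (Z : vfield (swann_bundle Q)),
        section_of (@vertical R _ M Q) u Z ->
        forall X Y, smooth_vfield u X -> smooth_vfield u Y ->
          lie_derivative Z omegahat X Y u = 0] /\
  [/\ is_form2 H omegahat /\ nondegenerate_on H omegahat,
      is_differential H (hproj theta) omegahat (form3_0 (swann_bundle Q)),
      Hermitian_on theta H omegahat &
      forall eta : form3 (swann_bundle Q), ext_d omegahat eta ->
        is_differential H (hproj theta) omegahat eta].

Proof.
move=> n1 [aQ [oform ondeg oherm] [_ tf _ par]] [[tform tfund _] _] omegahat H.
have m0 : (0 < 4 * n)%N by rewrite muln_gt0 (ltnW n1).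
have rM : regular M := manifold_regular.
have rW : regular (swann_bundle Q) := swann_regular.
have hproj_form u (x y : tangent u) : omegahat u (hproj theta x) y = omegahat u x y.
  by rewrite /omegahat /pullback dmap_hproj.
have koszulE X Y Z u : koszul (hproj theta) omegahat X Y Z u =
    koszul (fun _ => id) omegahat X Y Z u.
  by rewrite /koszul !hproj_form.
have form : is_form2 (TT (swann_bundle Q)) omegahat.
  split=> [u a x y z _ _ _|u x y _ _|u X Y [sX _] [sY _]].
  - exact: pullback_linear.
  - exact: pullback_anti.
  - have [c cu] := chart_cover (pihat u).
    exact: (smooth_pullback oform cu).
have kos u X Y Z : smooth_vfield u X -> smooth_vfield u Y -> smooth_vfield u Z ->
    koszul (fun _ => id) omegahat X Y Z u = 0.
  exact: (koszul_pullback oform tf par).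
have hor u (x y : tangent u) : vertical x -> omegahat u x y = 0.
  by rewrite /vertical /omegahat /pullback /= => ->; exact: form2_0l.
split; split.
- exact: form.
- by move=> u x y; exact: hor.
- move=> g u X Y; rewrite /omegahat /pullback.
  (* The action preserves fibres: [pihat (act g u)] is convertible with [pihat u]. *)
  have E (Z : tangent u) :
      dmap (@pihat _ _ _ Q) (dmap (act g) Z) = dmap (@pihat _ _ _ Q) Z.
    rewrite -(dmap_comp rW rW rM) //; first exact: smooth_act.
    exact: smooth_pihat.
  by rewrite !E.
- split=> [|u X Y Z [sX _] [sY _] [sZ _]]; first exact: is_form3_0.
  exact: kos.
- move=> u Z [sZ vZ] X Y sX sY.
  (* The contraction with [Z] vanishes on a whole neighbourhood, since [Z] is vertical there, so its
     derivatives vanish too. *)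
  have ZW (V W : vfield (swann_bundle Q)) : smooth_vfield u W ->
      V u (fun v => omegahat v (Z v) (W v)) = 0.
    move=> sW; rewrite -(der_cst rW (V u) 0); apply/esym.
    apply: (der_local rW); first exact: (smooth_cst rW).
    by apply: (nbhS rW _ vZ) => v /= /hor ->.
  (* Cartan's formula: the Koszul expression of [Z], [X], [Y] and the Lie derivative differ only by
     terms containing the contraction of the form with [Z]. *)
  have := kos u Z X Y sZ sX sY; rewrite /koszul /lie_derivative.
  rewrite (ZW X Y sY) (ZW Y X sX).
  have anti (x y : tangent u) : omegahat u x y = - omegahat u y x.
    exact: pullback_anti.
  rewrite (anti (bracket X Y u)) (hor _ _ _ (nbh_self rW vZ)) (anti (X u)).
  by rewrite !(oppr0, addr0) opprK.
- split; first exact: is_form2_sub.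
  move=> u x hx xH; apply: (horizontal_vertical m0 aQ tform tfund hx).
  apply: ondeg => // y _.
  have [Y [hY <-]] := horizontal_onto m0 aQ tform tfund y.
  exact: xH.
- split=> [|u X Y Z [sX _] [sY _] [sZ _]]; first exact: is_form3_0.
  by rewrite koszulE; exact: kos.
- move=> a u X Y hX hY; rewrite /omegahat /pullback.
  rewrite !(dmap_Ihat m0 aQ tform tfund)//.
  exact: (oherm _ (projT2 (toS u))).
- move=> eta [feta deta]; split; first exact: is_form3_sub.
  move=> u X Y Z [sX _] [sY _] [sZ _]; rewrite koszulE; apply: deta;
    by split=> //; exact: (nbhT rW).
Qed.
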